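(* Let $V\in L^\infty(0,2\pi)$ be complex-valued, $\rho\in\mathbb{C}\setminus\{0\}$ and $k\in L^2(0,2\pi)$. Consider for $\lambda\in\mathbb{C}$ the equation $$e^{i\int_0^{2\pi}(V(t)-\lambda)\,dt}\left(i\int_0^{2\pi}e^{-i\int_0^t(V(s)-\lambda)\,ds}k(t)\,dt+\rho\right)=1.\qquad( * )$$ Then the spectrum of $A_{\rho,k}$ consists only of eigenvalues and is given by $$\sigma(A_{\rho,k})=\{\lambda\in\mathbb{C}\mid\lambda\text{ satisfies }( * )\},$$ where the geometric multiplicity of each eigenvalue is $\dim\ker(A_{\rho,k}-\lambda)=1$. The corresponding eigenfunctions are given (up to scalar multiples) by $$\phi_\lambda(x)=\frac{1}{\sqrt{2\pi}}e^{i\int_0^xV(t)dt-i\lambda x}\left(i\int_0^xe^{-i\int_0^tV(s)ds+i\lambda t}k(t)\,dt+\rho\right).$$ Moreover, for $\lambda\in\mathbb{C}\setminus\sigma(A_{\rho,k})$ and $g\in L^2(0,2\pi)$, the resolvent $(A_{\rho,k}-\lambda)^{-1}$ is given by $$\left((A_{\rho,k}-\lambda)^{-1}g\right)(x)=\frac{-i}{I_{V,\lambda}(x)}\left[\frac{\int_0^{2\pi}I_{V,\lambda}(t)g(t)\,dt}{I_{V,\lambda}(2\pi)-i\int_0^{2\pi}I_{V,\lambda}(t)k(t)\,dt-\rho}\left(\int_0^x iI_{V,\lambda}(t)k(t)\,dt+\rho\right)+\int_0^xI_{V,\lambda}(t)g(t)\,dt\right],$$ where $I_{V,\lambda}(x):=\exp\left(-i\int_0^xV(t)\,dt+i\lambda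 x\right)$.
   Context: The Hilbert space is $L^2(0,2\pi)$ (complex-valued functions). For complex-valued $V\in L^\infty(0,2\pi)$, $\rho\in\mathbb{C}\setminus\{0\}$ and $k\in L^2(0,2\pi)$, the operator $A_{\rho,k}$ in $L^2(0,2\pi)$ is defined by $$\mathrm{dom}(A_{\rho,k})=\{f\in H^1(0,2\pi)\mid f(0)=\rho f(2\pi)\},\qquad (A_{\rho,k}f)(x)=if'(x)+V(x)f(x)+f(2\pi)k(x).$$ $\sigma(\cdot)$ denotes the spectrum; the geometric multiplicity of an eigenvalue $\lambda$ is $\dim\ker(A_{\rho,k}-\lambda)$. *)

(* Defs.v *)
From HB Require Import structures.
From mathcomp Require Import all_boot all_order all_algebra ring_quotient.
From mathcomp Require Import complex.
From mathcomp Require Import all_classical all_reals all_analysis measurable_realfun.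
From mathcomp Require Import ring lra.

Set Implicit Arguments.
Unset Strict Implicit.
Unset Printing Implicit Defensive.

Import Order.TTheory GRing.Theory Num.Theory.
Import numFieldNormedType.Exports.
Import ComplexField.Normc.

Local Open Scope classical_set_scope.
Local Open Scope ring_scope.
Local Open Scope complex_scope.
Local Open Scope quotient_scope.

Local Notation Re := (@complex.Re _).
Local Notation Im := (@complex.Im _).

Section ComplexAnalysis.
Context {R : realType}.
Implicit Types (z : R[i]) (u : R -> R[i]) (D : set R).

Definition cexp z : R[i] :=
  (expR (Re z))%:C * (cos (Im z) +i* sin (Im z)).

(* The Lebesgue integral of u from a to b, only meant for a <= b. *)
Definition cint (a b : R) u : R[i] :=
  (\int[lebesgue_measure]_(x in `[a, b]) Re (u x)) +i*
  (\int[lebesgue_measure]_(x in `[a, b]) Im (u x)).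

Definition cmeasurable D u :=
  measurable_fun D (Re \o u) /\ measurable_fun D (Im \o u).

Definition ccontinuous_on D u :=
  {within D, continuous (Re \o u)} /\
  {within D, continuous (Im \o u)}.

End ComplexAnalysis.

Definition I2pi (R : realType) : set R := `]0, 2 * pi[%classic.
Arguments I2pi {R}.

Definition Linfty (R : realType) (V : R -> R[i]) : Prop :=
  cmeasurable I2pi V /\
  exists M : R, \forall x \ae lebesgue_measure, I2pi x -> normc (V x) <= M.

#[global] Instance lebesgue_ae_filter (R : realType) :
  Filter (nbhs (almost_everywhere (@lebesgue_measure R))) :=
  ae_filter_ringOfSetsType lebesgue_measure.

Section SquareIntegrable.
Context {R : realType}.
Implicit Types (z : R[i]) (u v : R -> R[i]).

Definition square_integrable u : Prop :=
  cmeasurable I2pi u /\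
  lebesgue_measure.-integrable I2pi (fun x => (normc (u x) ^+ 2)%:E).

Lemma normc_sqr z : normc z ^+ 2 = Re z ^+ 2 + Im z ^+ 2.
Proof. by case: z => a b /=; rewrite sqr_sqrtr// addr_ge0// sqr_ge0. Qed.

Lemma measurable_I2pi : measurable (@I2pi R).
Proof. exact: measurable_itv. Qed.

Lemma measurable_normc_sqr u : cmeasurable I2pi u ->
  measurable_fun I2pi (fun x => normc (u x) ^+ 2).
Proof.
move=> [mr mi].
under eq_fun do rewrite normc_sqr.
by apply: measurable_funD; apply: measurable_funX.
Qed.

Lemma cmeasurableZD (a : R[i]) u v :
  cmeasurable I2pi u -> cmeasurable I2pi v -> cmeasurable I2pi (a *: u + v).
Proof.
case: a => a b [ur ui] [vr vi]; split.
- rewrite (_ : _ \o _ = (fun x => (a * Re (u x) - b * Im (u x))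
    + Re (v x))); last first.
    by apply/funext => x /=; rewrite !fctE; case: (u x) => ? ?; case: (v x).
  by apply: measurable_funD => //; apply: measurable_funB;
    apply: measurable_funM.
- rewrite (_ : _ \o _ = (fun x => (a * Im (u x) + b * Re (u x))
    + Im (v x))); last first.
    by apply/funext => x /=; rewrite !fctE; case: (u x) => ? ?; case: (v x).
  by apply: measurable_funD => //; apply: measurable_funD;
    apply: measurable_funM.
Qed.

Lemma cmeasurableM u v :
  cmeasurable I2pi u -> cmeasurable I2pi v ->
  cmeasurable I2pi (fun x => u x * v x).
Proof.
move=> [ur ui] [vr vi]; split.
- rewrite (_ : _ \o _ = (fun x => Re (u x) * Re (v x) -
    Im (u x) * Im (v x))); last first.
    by apply/funext => x /=; case: (u x) => ? ?; case: (v x).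
  by apply: measurable_funB; apply: measurable_funM.
- rewrite (_ : _ \o _ = (fun x => Re (u x) * Im (v x) +
    Im (u x) * Re (v x))); last first.
    by apply/funext => x /=; case: (u x) => ? ?; case: (v x).
  by apply: measurable_funD; apply: measurable_funM.
Qed.

Lemma normc_sqrZD (a z w : R[i]) :
  normc (a * z + w) ^+ 2 <= 2 * normc a ^+ 2 * normc z ^+ 2 + 2 * normc w ^+ 2.
Proof.
rewrite !normc_sqr; case: a z w => [a b] [c d] [e f] /=.
have H1 := sqr_ge0 (a * c - b * d - e); have H2 := sqr_ge0 (a * d + b * c - f).
lra.
Qed.

Lemma square_integrableZD (a : R[i]) u v :
  square_integrable u -> square_integrable v -> square_integrable (a *: u + v).
Proof.
move=> [mu iu] [mv iv]; have muv := cmeasurableZD a mu mv; split => //.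
have mI := measurable_I2pi.
apply: (@le_integrable _ _ _ lebesgue_measure I2pi _ _
  (fun x => ((2 * normc a ^+ 2)%:E * (normc (u x) ^+ 2)%:E
     + 2%:E * (normc (v x) ^+ 2)%:E)%E)) => //.
- by apply/measurable_EFinP; exact: measurable_normc_sqr.
- move=> x _; rewrite -2!EFinM -EFinD /=.
  rewrite lee_fin !ger0_norm ?sqr_ge0//.
  + exact: normc_sqrZD.
  + by apply: addr_ge0; do ?[exact: sqr_ge0 | apply: mulr_ge0] => //.
- by apply: integrableD => //; apply: integrableZl.
Qed.

Lemma square_integrable0 : square_integrable 0.
Proof.
split; first by split; exact: measurable_cst.
under eq_fun do rewrite /= expr0n/= addr0 sqrtr0 expr0n/=.
exact: integrable0.
Qed.

Definition sqint : {pred R -> R[i]} := [pred u | `[< square_integrable u >]].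

Lemma sqint_submod_closed : submod_closed sqint.
Proof.
split; first by rewrite inE; exact: square_integrable0.
move=> a u v /[!inE] hu hv.
exact: square_integrableZD.
Qed.

HB.instance Definition _ :=
  GRing.isSubmodClosed.Build _ _ sqint sqint_submod_closed.

End SquareIntegrable.

Record L2fun (R : realType) :=
  MkL2fun { L2fun_val :> R -> R[i]; L2funP : L2fun_val \in sqint }.

Section L2fun_lmod.
Variable R : realType.
HB.instance Definition _ := [isSub for @L2fun_val R].
HB.instance Definition _ := [Choice of L2fun R by <:].
HB.instance Definition _ := [SubChoice_isSubLmodule of L2fun R by <:].

Definition L2null : {pred L2fun R} :=
  [pred u : L2fun R | `[< (u : R -> R[i]) = cst 0 %[ae lebesgue_measure in I2pi] >]].

Lemma L2null_submod_closed : submod_closed L2null.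
Proof.
split; first by rewrite inE; exact: aeW.
move=> a u v /[!inE] hu hv.
apply: filterS2 hu hv => x ux vx Ix /=.
by rewrite !fctE ux// vx// scaler0 addr0.
Qed.

HB.instance Definition _ :=
  GRing.isSubmodClosed.Build _ _ L2null L2null_submod_closed.

End L2fun_lmod.

(* L^2(0, 2 pi): square-integrable functions modulo equality a.e. on ]0, 2 pi[. *)
Definition L2 (R : realType) : Type := Quotient.quot (@L2null R).

Section L2_lmod.
Variable R : realType.

HB.instance Definition _ := GRing.Zmodule.on (L2 R).
HB.instance Definition _ := EqQuotient.on (L2 R).

Implicit Types (f g : L2 R) (a b : R[i]).

(* A representative of the class f. *)
Definition L2_fun f : R -> R[i] := (repr f : L2fun R).

Coercion L2_fun : L2 >-> Funclass.

Definition L2_scale a f : L2 R := \pi_(L2 R) (a *: (repr f : L2fun R)).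

Lemma pi_L2_scale a (u : L2fun R) :
  L2_scale a (\pi_(L2 R) u) = \pi_(L2 R) (a *: u).
Proof.
apply/eqP; rewrite /L2_scale -Quotient.idealrBE -scalerBr rpredZ//.
by rewrite Quotient.idealrBE reprK.
Qed.

Lemma pi_L2_add (u v : L2fun R) :
  \pi_(L2 R) u + \pi_(L2 R) v = \pi_(L2 R) (u + v).
Proof. exact/esym/Quotient.pi_add. Qed.

Lemma L2_scalerA a b f : L2_scale a (L2_scale b f) = L2_scale (a * b) f.
Proof. by rewrite -[f]reprK !pi_L2_scale scalerA reprK. Qed.

Lemma L2_scale1r : left_id 1 L2_scale.
Proof. by move=> f; rewrite -[f]reprK pi_L2_scale scale1r. Qed.

Lemma L2_scalerDr : right_distributive L2_scale +%R.
Proof.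
move=> a f g; rewrite -[f]reprK -[g]reprK.
by rewrite pi_L2_add !pi_L2_scale pi_L2_add scalerDr.
Qed.

Lemma L2_scalerDl f : {morph L2_scale^~ f : a b / a + b}.
Proof.
by move=> a b; rewrite -[f]reprK !pi_L2_scale pi_L2_add scalerDl.
Qed.

HB.instance Definition _ := GRing.Zmodule_isLmodule.Build R[i] (L2 R)
  L2_scalerA L2_scale1r L2_scalerDr L2_scalerDl.

End L2_lmod.

Section L2_theory.
Variable R : realType.
Implicit Types (u v : R -> R[i]) (f g : L2 R) (a : R[i]).

Local Notation "u =ae v" := (u = v %[ae lebesgue_measure in I2pi])
  (at level 70).

(* The class of u; it is 0 when u is not square integrable. *)
Definition toL2 u : L2 R :=
  if insub u is Some w then \pi_(L2 R) (w : L2fun R) else 0.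

Lemma L2_fun_square_integrable f : square_integrable (f : R -> R[i]).
Proof. by have := L2funP (repr f); rewrite inE. Qed.

Lemma pi_L2P (v w : L2fun R) : \pi_(L2 R) v = \pi_(L2 R) w <->
  (v : R -> R[i]) =ae (w : R -> R[i]).
Proof.
have E : (\pi_(L2 R) v == \pi_(L2 R) w) =
    `[< (v - w : R -> R[i]) =ae cst 0 >].
  by rewrite -Quotient.idealrBE.
split=> [/eqP|vw]; last apply/eqP; rewrite E.
  move=> /asboolP; apply: filterS => x /[apply]; rewrite !fctE.
  by move=> /subr0_eq.
apply/asboolP; apply: filterS vw => x /[apply] e.
by rewrite -[LHS]/((v : R -> R[i]) x - (w : R -> R[i]) x) e subrr.
Qed.

Lemma L2_eqP f g : f = g <-> (f : R -> R[i]) =ae g.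
Proof. by rewrite -[f in f = _]reprK -[g in _ = g]reprK pi_L2P. Qed.

Lemma toL2E u : square_integrable u -> (toL2 u : R -> R[i]) =ae u.
Proof.
move=> su; rewrite /toL2; case: insubP => [w _ wu|]; last first.
  by rewrite inE => /asboolPn /(_ su).
by rewrite -[in X in _ =ae X]wu; apply/pi_L2P; rewrite reprK.
Qed.

Lemma L2_funD f g : (f + g : L2 R) =ae (fun x => f x + g x).
Proof.
have : \pi_(L2 R) (repr (f + g)) = \pi_(L2 R) (repr f + repr g).
  by rewrite -pi_L2_add !reprK.
by move=> /pi_L2P.
Qed.

Lemma L2_funZ a f : (a *: f : L2 R) =ae (fun x => a * f x).
Proof.
have : \pi_(L2 R) (repr (a *: f)) = \pi_(L2 R) (a *: repr f).
  by rewrite -pi_L2_scale !reprK.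
by move=> /pi_L2P.
Qed.

End L2_theory.

Section Operators.
Variable R : realType.
Implicit Types (f g : L2 R) (lambda : R[i]).

Definition L2norm f : R :=
  Num.sqrt (\int[lebesgue_measure]_(x in I2pi) (normc (f x) ^+ 2)).

(* A possibly unbounded operator in L^2(0, 2 pi); the values of [app] outside
   [dom] are irrelevant. *)
Record operator := Operator {
  dom : set (L2 R);
  app : L2 R -> L2 R }.

Implicit Type A : operator.

Definition shift_rel A lambda f g := dom A f /\ app A f - lambda *: f = g.

(* (A - lambda)^-1 g, when it is well defined. *)
Definition resolvent A lambda g : L2 R :=
  xget 0 [set f | shift_rel A lambda f g].

Definition resolvent_set A : set R[i] := [set lambda |
  (forall g, exists! f, shift_rel A lambda f g) /\
  exists M : R, forall g, L2norm (resolvent A lambda g) <= M * L2norm g].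

Definition spectrum A : set R[i] := ~` resolvent_set A.

Definition ker_shift A lambda : set (L2 R) := [set f | shift_rel A lambda f 0].

Definition is_eigenfunction A lambda f := f != 0 /\ ker_shift A lambda f.

Definition is_eigenvalue A lambda := exists f, is_eigenfunction A lambda f.

End Operators.

(* The subset W of H is a linear subspace of dimension n. *)
Definition has_dim (K : fieldType) (H : lmodType K) (W : set H) (n : nat) :=
  exists e : 'I_n -> H,
    (forall c : 'I_n -> K, \sum_(i < n) c i *: e i = 0 -> forall i, c i = 0) /\
    W = [set v | exists c : 'I_n -> K, v = \sum_(i < n) c i *: e i].

Section Sobolev.
Variable R : realType.
Implicit Types (f g : L2 R) (u : R -> R[i]).

(* C^1 functions with compact support in ]0, 2 pi[, as in the definition of
   W^{1,p} on an interval in Brezis, Functional Analysis, Section 8.2; by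
   linearity, it makes no difference to test against real or against complex
   functions. *)
Definition test_function (phi : R -> R) : Prop :=
  [/\ forall x, derivable phi x 1,
      continuous (derive1 phi : R -> R) &
      exists a b : R, [/\ 0 < a, b < 2 * pi &
        forall x, x \notin `[a, b] -> phi x = 0]].

Definition is_weak_derivative f g : Prop :=
  forall phi : R -> R, test_function phi ->
    cint 0 (2 * pi) (fun x => f x * (derive1 phi x)%:C) =
    - cint 0 (2 * pi) (fun x => g x * (phi x)%:C).

Definition H1 : set (L2 R) := [set f | exists g, is_weak_derivative f g].

Definition weak_derivative f : L2 R := xget 0 [set g | is_weak_derivative f g].

Definition is_continuous_representative f u : Prop :=
  ccontinuous_on `[0, 2 * pi] u /\
  (f : R -> R[i]) = u %[ae lebesgue_measure in I2pi].

(* The pointwise values on [0, 2 pi] of f in H^1(0, 2 pi) are those of its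
   continuous representative. *)
Definition pointwise f : R -> R[i] :=
  xget (cst 0) [set u | is_continuous_representative f u].

(* i f' + V f + f(2 pi) k on {f in H^1 | f(0) = rho f(2 pi)} *)
Definition A_op (V : R -> R[i]) (rho : R[i]) (k : L2 R) : operator R := {|
  dom := [set f | H1 f /\ pointwise f 0 = rho * pointwise f (2 * pi)];
  app := fun f => 'i%C *: weak_derivative f + toL2 (fun x => V x * f x) +
                  pointwise f (2 * pi) *: k |}.

Lemma square_integrable_Linfty_mul (V : R -> R[i]) f :
  Linfty V -> square_integrable (fun x => V x * f x).
Proof.
move=> [mV [M VM]]; have [mf intf] := L2_fun_square_integrable f.
have mVf := cmeasurableM mV mf; split => //.
have mI := @measurable_I2pi R.
have mE : measurable_fun I2pi (fun x => (normc (V x * f x) ^+ 2)%:E).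
  by apply/measurable_EFinP; exact: measurable_normc_sqr.
apply/integrableP; split => //.
have iM : lebesgue_measure.-integrable I2pi
    (fun x => ((M ^+ 2)%:E * (normc (f x) ^+ 2)%:E)%E) by exact: integrableZl.
have /integrableP[mMf] := iM; apply: le_lt_trans.
apply: ae_ge0_le_integral => //.
- by apply: measurableT_comp.
- by apply: measurableT_comp.
apply: filterS VM => x /[apply] VM.
have V0 : 0 <= normc (V x) by case: (V x) => a b /=; exact: sqrtr_ge0.
rewrite -EFinM !abse_EFin lee_fin !ger0_norm ?(sqr_ge0, mulr_ge0)//.
by rewrite normcM exprMn ler_wpM2r ?sqr_ge0// ler_pXn2r// nnegrE (le_trans V0).
Qed.

Lemma toL2_Linfty_mulE (V : R -> R[i]) f : Linfty V ->
  (toL2 (fun x => V x * f x) : R -> R[i]) = (fun x => V x * f x)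
    %[ae lebesgue_measure in I2pi].
Proof. by move=> VL; exact/toL2E/square_integrable_Linfty_mul. Qed.

Definition I_exp (V : R -> R[i]) (lambda : R[i]) (x : R) : R[i] :=
  cexp (- 'i%C * cint 0 x V + 'i%C * lambda * x%:C).

End Sobolev.

(* Main.v *)
(* Fix [lambda] and let [I] be the integrating factor [I_exp V lambda], so that
   [I' = i (lambda - V) I] a.e.  For [f] in H^1 with [f(2 pi) = c], the equation
   [i f' + (V - lambda) f + c k = g] says that [(I f)' = i I (c k - g)].
   Integrating, and using [f(0) = rho c], gives
     [I(x) f(x) = c (rho + i int_0^x I k) - i int_0^x I g],
   and the value at [2 pi] must be [c], that is
     [c D = - i int_0^{2 pi} I g],  [D = I(2 pi) - rho - i int_0^{2 pi} I k].
   If [D <> 0] then [c], hence [f], is determined by [g] and bounded by its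
   norm; if [D = 0] then the solutions for [g = 0] form a line.  Equation ( * )
   is [D = 0].

   The product and chain rules for absolutely continuous functions follow from
   the fact that a function whose increments are locally dominated by [eps]
   times those of an integral, for every [eps > 0], is constant.  A weak
   derivative is turned into a primitive by testing against the difference of
   two smooth steps concentrated at Lebesgue points (du Bois-Reymond). *)

Require Import Defs.
From mathcomp Require Import all_boot all_order all_algebra complex.
From mathcomp Require Import all_classical all_reals all_analysis.
From mathcomp Require Import measurable_realfun.
From mathcomp Require Import ring lra.

Set Implicit Arguments.
Unset Strict Implicit.
Unset Printing Implicit Defensive.

Import Order.TTheory GRing.Theory Num.Theory.
Import numFieldNormedType.Exports.
Import ComplexField.Normc.

Local Open Scope classical_set_scope.
Local Open Scope ring_scope.
Local Open Scope complex_scope.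

Local Notation Re := (@complex.Re _).
Local Notation Im := (@complex.Im _).

(** * Primitives of integrable functions *)

Section Primitives.
Context {R : realType}.
Implicit Types (a b x y z eps : R) (f g F G m : R -> R).
Local Notation mu := (@lebesgue_measure R).

(** Absolute continuity of [F] with derivative [f] almost everywhere, encoded by the integral
    identity. *)
Definition is_primitive a b f F :=
  mu.-integrable `[a, b] (EFin \o f) /\
  forall x, x \in `[a, b] -> F x = F a + \int[mu]_(t in `[a, x]) f t.

Lemma subset_itvoc_itvcc a b y z : a <= y -> z <= b ->
  `]y, z]%classic `<=` `[a, b]%classic.
Proof.
move=> ay zb t /=; rewrite !in_itv/= => /andP[yt tz].
by rewrite (le_trans ay (ltW yt)) (le_trans tz zb).
Qed.

Lemma Rintegral_itvcc_split f a y z : a <= y -> y <= z ->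
  mu.-integrable `[a, z] (EFin \o f) ->
  \int[mu]_(t in `[a, z]) f t =
  \int[mu]_(t in `[a, y]) f t + \int[mu]_(t in `]y, z]) f t.
Proof.
move=> ay yz fi.
by rewrite -(Rintegral_itvB fi) ?bnd_simp// addrC subrK.
Qed.

Lemma primitive_increment a b f F y z : is_primitive a b f F ->
  a <= y -> y <= z -> z <= b -> F z - F y = \int[mu]_(t in `]y, z]) f t.
Proof.
move=> [fi FE] ay yz zb; rewrite (FE z) ?(FE y) ?in_itv/=.
- rewrite (@Rintegral_itvcc_split f a y z)//; first by ring.
  apply: integrableS fi => // t /=.
  by rewrite !in_itv/= => /andP[-> /le_trans]; apply.
- by rewrite ay (le_trans yz).
- by rewrite (le_trans ay yz).
Qed.

(* The supremum of the points up to which the inequality holds can only be the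
   right endpoint. *)
Lemma locally_dominated_increments a b G m eps : a <= b ->
  (forall x, x \in `[a, b] -> exists2 d : R, 0 < d &
     forall y z, a <= y -> y <= z -> z <= b -> `|y - x| < d -> `|z - x| < d ->
     `|G z - G y| <= eps * (m z - m y)) ->
  `|G b - G a| <= eps * (m b - m a).
Proof.
move=> ab loc.
pose S := [set x | x \in `[a, b] /\ `|G x - G a| <= eps * (m x - m a)].
have Sa : S a by split; rewrite ?in_itv/= ?lexx// !subrr normr0 mulr0.
have ubS : ubound S b by move=> x [] /[!in_itv]/= /andP[].
have supS : has_sup S by split; [exists a|exists b].
have Sext y z : S y -> a <= y -> y <= z -> z <= b ->
    `|G z - G y| <= eps * (m z - m y) -> S z.
  move=> [_ Gy] ay yz zb Gzy; split; first by rewrite in_itv/= (le_trans ay yz).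
  rewrite (_ : G z - G a = (G z - G y) + (G y - G a)); last by ring.
  rewrite (le_trans (ler_normD _ _))//.
  rewrite (_ : m z - m a = (m z - m y) + (m y - m a)); last by ring.
  by rewrite mulrDr lerD.
have as' : a <= sup S by apply: ub_le_sup => //; exact: supS.2.
have sb : sup S <= b by apply: sup_le_ub => //; exact: supS.1.
have sab : sup S \in `[a, b] by rewrite in_itv/= as'.
have [d d0 dG] := loc _ sab.
have [t St tS] := sup_adherent d0 supS.
have [/[!in_itv]/= /andP[at' tb] _] := St.
have ts : t <= sup S by apply: ub_le_sup => //; exact: supS.2.
(* The supremum is attained: a point of [S] within [d] of it transfers the inequality. *)
have Ss : S (sup S).
  apply: (Sext t) => //; apply: dG => //.
  - by rewrite ler0_norm ?subr_le0// opprB; lra.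
  - by rewrite subrr normr0.
have [sltb|bles] := ltP (sup S) b; last first.
  by have /eqP <- : sup S == b; [rewrite eq_le sb|exact: Ss.2].
(* If [sup S < b], a point strictly beyond it but still within [d] also lies in [S], a
   contradiction. *)
pose u := Num.min b (sup S + d / 2).
have su : sup S < u by rewrite lt_min sltb/= ltrDl divr_gt0.
have ub : u <= b by rewrite ge_min lexx.
have ud : u <= sup S + d / 2 by rewrite ge_min lexx orbT.
have Su : S u.
  apply: (Sext (sup S)) => //; first exact: ltW.
  apply: dG => //; first exact: ltW.
  - by rewrite subrr normr0.
  - by rewrite ger0_norm ?subr_ge0; [lra|exact: ltW].
suff : u <= sup S by rewrite leNgt su.
by apply: ub_le_sup => //; exact: supS.2.
Qed.

(** Subtracting the integral of [f] from [F] leaves a function whose increments are locally at most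
    [eps] times those of the integral of [h]; since [eps] is arbitrary, it is constant. In the
    product and chain rules, [h] absorbs the error terms. *)
Lemma is_primitive_loc a b f F h : a <= b ->
  mu.-integrable `[a, b] (EFin \o f) -> mu.-integrable `[a, b] (EFin \o h) ->
  (forall eps, 0 < eps -> forall x, x \in `[a, b] -> exists2 d : R, 0 < d &
     forall y z, a <= y -> y <= z -> z <= b -> `|y - x| < d -> `|z - x| < d ->
     `|F z - F y - \int[mu]_(t in `]y, z]) f t| <=
       eps * \int[mu]_(t in `]y, z]) h t) ->
  is_primitive a b f F.
Proof.
move=> ab fi hi loc; split=> // x /[!in_itv]/= /andP[ax xb].
pose P g (w : R) := \int[mu]_(t in `[a, w]) g t.
have PB g y z : mu.-integrable `[a, b] (EFin \o g) -> a <= y -> y <= z ->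
    z <= b -> P g z - P g y = \int[mu]_(t in `]y, z]) g t.
  by move=> gi; apply: primitive_increment; split => // w _;
    rewrite /P [in RHS]set_itv1 Rintegral_set1 add0r.
pose G w := F w - P f w.
have Pa g : P g a = 0 by rewrite /P set_itv1 Rintegral_set1.
suff : G x = G a by rewrite /G Pa subr0 => <-; rewrite /P subrK.
apply/eqP; rewrite -subr_eq0 -normr_le0; apply/ler_addgt0Pl => e e0.
(* Domination is used with [eps = e / M]; the added 1 keeps [M] positive when the integral of [h]
   vanishes. *)
rewrite addr0; pose M := `|P h x - P h a| + 1.
have M0 : 0 < M by rewrite ltr_wpDl.
apply: (@le_trans _ _ (e / M * (P h x - P h a))).
  apply: locally_dominated_increments => // w /[!in_itv]/= /andP[aw wx].
  have wab : w \in `[a, b] by rewrite in_itv/= aw (le_trans wx).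
  have [d d0 dF] := loc (e / M) (divr_gt0 e0 M0) _ wab.
  exists d => // y z ay yz zx yd zd.
  rewrite /G PB// ?(le_trans zx)//.
  rewrite (_ : _ - _ = F z - F y - (P f z - P f y)); last by ring.
  by rewrite PB ?(le_trans zx)//; apply: dF => //; rewrite (le_trans zx).
rewrite -mulrA ler_piMr ?(ltW e0)// mulrC ler_pdivrMr// mul1r.
by rewrite (le_trans (ler_norm _))// lerDl.
Qed.

End Primitives.

(** * Integrability and domination for real-valued functions *)

Section RealIntegrable.
Context d (T : measurableType d) {R : realType}.
Variable mu : {measure set T -> \bar R}.
Implicit Types (A : set T) (f g h : T -> R).

Lemma integrable_realD A f g : measurable A -> mu.-integrable A (EFin \o f) ->
  mu.-integrable A (EFin \o g) ->
  mu.-integrable A (EFin \o (fun x => f x + g x)).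
Proof. by move=> mA fi gi; have := integrableD mA fi gi. Qed.

Lemma integrable_realB A f g : measurable A -> mu.-integrable A (EFin \o f) ->
  mu.-integrable A (EFin \o g) ->
  mu.-integrable A (EFin \o (fun x => f x - g x)).
Proof. by move=> mA fi gi; have := integrableB mA fi gi. Qed.

Lemma integrable_realZ A (c : R) f : measurable A ->
  mu.-integrable A (EFin \o f) -> mu.-integrable A (EFin \o (fun x => c * f x)).
Proof. by move=> mA fi; have := integrableZl mA c fi. Qed.

Lemma le_normr_Rintegral_dominated A f h : measurable A ->
  mu.-integrable A (EFin \o f) -> mu.-integrable A (EFin \o h) ->
  (forall x, A x -> `|f x| <= h x) ->
  `|\int[mu]_(t in A) f t| <= \int[mu]_(t in A) h t.
Proof.
move=> mA fi hi fh; rewrite (le_trans (le_normr_Rintegral mA fi))//.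
by apply: le_Rintegral => //; exact: integrable_norm.
Qed.

Lemma integrable_realM A f h : measurable A -> mu.-integrable A (EFin \o f) ->
  measurable_fun A h -> [bounded h x | x in A] ->
  mu.-integrable A (EFin \o (fun x => f x * h x)).
Proof. by move=> mA fi mh bh; have := integrableMl mA fi mh bh. Qed.

End RealIntegrable.

(** * Product and chain rules for absolutely continuous functions *)

Section PrimitiveCalculus.
Context {R : realType}.
Implicit Types (A : set R) (a b c x y z eps : R) (f g F G : R -> R).
Local Notation mu := (@lebesgue_measure R).

Lemma is_primitive_continuous a b f F : a <= b -> is_primitive a b f F ->
  {within `[a, b], continuous F}.
Proof.
move=> ab [fi FE]; have Ic := parameterized_integral_continuous ab fi.
have Fc : {within `[a, b], continuous
    (cst (F a) + (fun x => \int[mu]_(t in `[a, x]) f t) : R -> R)}.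
  apply: within_continuousD Ic.
  by apply: continuous_subspaceT => x; exact: cvg_cst.
apply: (subspace_eq_continuous _ Fc) => x xab.
by move: xab; rewrite inE => xab; exact: (esym (FE x xab)).
Qed.

Lemma within_continuous_dist A F x eps : 0 < eps -> A x ->
  {within A, continuous F} ->
  exists2 d : R, 0 < d & forall y, A y -> `|y - x| < d -> `|F y - F x| < eps.
Proof.
move=> e0 Ax /subspace_continuousP/(_ x Ax)/cvgrPdist_lt/(_ _ e0).
move=> [d /= d0 dF]; exists d => // y Ay yx.
by rewrite distrC; apply: dF => //=; rewrite distrC.
Qed.

Lemma integrableM_continuous a b f G : mu.-integrable `[a, b] (EFin \o f) ->
  {within `[a, b], continuous G} ->
  mu.-integrable `[a, b] (EFin \o (fun x => f x * G x)).
Proof.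
move=> fi Gc; have mab : measurable (`[a, b]%classic : set R) by [].
have mG := subspace_continuous_measurable_fun mab Gc.
have Gb : [bounded G x | x in `[a, b]%classic].
  have := compact_bounded (continuous_compact Gc (@segment_compact _ a b)).
  by move=> [M [Mr MG]]; exists M; split => // N MN x xab; apply: (MG N MN);
    exists x.
exact: integrable_realM.
Qed.

(** The density matters only almost everywhere, the primitive everywhere on the interval; this is
    how representatives of L^2 classes get exchanged. *)
Lemma eq_is_primitive a b f g F G : measurable_fun `[a, b] g ->
  f = g %[ae mu in `[a, b]%classic] -> {in `[a, b], F =1 G} ->
  is_primitive a b f F -> is_primitive a b g G.
Proof.
move=> mg fg FG [fi FE].
have mab : measurable (`[a, b]%classic : set R) by [].
have sub x : x \in `[a, b] -> `[a, x]%classic `<=` `[a, b]%classic.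
  rewrite in_itv/= => /andP[_ xb] t /=.
  by rewrite !in_itv/= => /andP[-> /le_trans]; apply.
have mE : measurable_fun `[a, b] (EFin \o g) by exact/measurable_EFinP.
split.
  apply/integrableP; split => //; case/integrableP : fi => mf;
    apply: le_lt_trans.
  rewrite le_eqVlt; apply/orP; left; apply/eqP.
  apply: ae_eq_integral => //; do ?exact: measurableT_comp.
  by apply: filterS fg => t /[apply] /= ->.
move=> x xab; have := xab; rewrite in_itv/= => /andP[ax xb].
rewrite -!FG ?in_itv/= ?ax ?lexx ?(le_trans ax)// FE//; congr (_ + _).
congr fine; apply: ae_eq_integral => //.
- by apply: measurable_funS (measurable_int _ fi) => //; exact: sub.
- by apply: measurable_funS mE => //; exact: sub.
- by apply: filterS fg => t ft /(sub _ xab)/ft /= ->.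
Qed.

Lemma integrable_itvcc_prefix a b f x : x \in `[a, b] ->
  mu.-integrable `[a, b] (EFin \o f) -> mu.-integrable `[a, x] (EFin \o f).
Proof.
rewrite in_itv/= => /andP[_ xb]; apply: integrableS => // t /=.
by rewrite !in_itv/= => /andP[-> /le_trans]; apply.
Qed.

Lemma is_primitiveD a b f F g G : is_primitive a b f F ->
  is_primitive a b g G ->
  is_primitive a b (fun x => f x + g x) (fun x => F x + G x).
Proof.
move=> [fi FE] [gi GE]; split; first exact: integrable_realD.
move=> x xab; rewrite (FE x xab) (GE x xab) RintegralD//.
- by rewrite addrACA.
- exact: integrable_itvcc_prefix fi.
- exact: integrable_itvcc_prefix gi.
Qed.

Lemma is_primitiveZ a b c f F : is_primitive a b f F ->
  is_primitive a b (fun x => c * f x) (fun x => c * F x).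
Proof.
move=> [fi FE]; split; first exact: integrable_realZ.
move=> x xab; rewrite (FE x xab) RintegralZl// ?mulrDr//.
exact: integrable_itvcc_prefix fi.
Qed.

Lemma between_dist_lt x y z d (t : R) : y <= t -> t <= z ->
  `|y - x| < d -> `|z - x| < d -> `|t - x| < d.
Proof.
move=> yt tz; rewrite !ltr_norml => /andP[yd _] /andP[_ zd].
by apply/andP; split; [apply: lt_le_trans yd _|apply: le_lt_trans zd];
  rewrite lerD2r.
Qed.

(** On a short interval []y, z]] the increment of [F G] is [G z (F z - F y) + F y (G z - G y)], so
    the error is the integral of [f (G z - G) + g (F y - F)], which continuity bounds by [eps] times
    the integral of [|f| + |g|]. *)
Lemma is_primitiveM a b f F g G : a <= b -> is_primitive a b f F ->
  is_primitive a b g G ->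
  is_primitive a b (fun x => f x * G x + g x * F x) (fun x => F x * G x).
Proof.
move=> ab pF pG; have [fi _] := pF; have [gi _] := pG.
have Fc := is_primitive_continuous ab pF.
have Gc := is_primitive_continuous ab pG.
have mab : measurable (`[a, b]%classic : set R) by [].
have fGi := integrableM_continuous fi Gc.
have gFi := integrableM_continuous gi Fc.
apply: (@is_primitive_loc _ _ _ _ _ (fun x => `|f x| + `|g x|)) => //.
- exact: integrable_realD.
- by apply: integrable_realD => //; exact: integrable_norm.
move=> eps e0 x xab; have e20 : 0 < eps / 2 by rewrite divr_gt0.
have [d d0 dF] := within_continuous_dist e20 xab Fc.
have [d' d'0 dG] := within_continuous_dist e20 xab Gc.
exists (Num.min d d'); first by rewrite lt_min d0.
move=> y z ay yz zb; rewrite !lt_min => /andP[yd yd'] /andP[zd zd'].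
have sub := subset_itvoc_itvcc ay zb.
have close (H : R -> R) (d0' : R) : (forall y, `[a, b]%classic y ->
  `|y - x| < d0' -> `|H y - H x| < eps / 2) ->
    forall u v, u \in `[a, b] -> v \in `[a, b] -> `|u - x| < d0' ->
      `|v - x| < d0' ->
    `|H u - H v| <= eps.
  move=> dH u v uab vab ud vd;
    rewrite (_ : H u - H v = (H u - H x) - (H v - H x)); last by ring.
  rewrite (le_trans (ler_normB _ _))// [leRHS]splitr.
  by rewrite lerD// ltW// dH.
have inab t : y <= t -> t <= z ->
  [/\ t \in `[a, b], `|t - x| < d & `|t - x| < d'].
  move=> yt tz; rewrite in_itv/= (le_trans ay yt) (le_trans tz zb).
  by split=> //; [exact: between_dist_lt yd zd|exact: between_dist_lt yd' zd'].
have [yab yxd yxd'] := inab y (lexx _) yz.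
have [zab zxd zxd'] := inab z yz (lexx _).
have S h : mu.-integrable `[a, b] (EFin \o h) ->
  mu.-integrable `]y, z] (EFin \o h).
  by move=> hi; exact: integrableS hi.
have E : F z * G z - F y * G y - \int[mu]_(t in `]y,
  z]) (f t * G t + g t * F t) =
    \int[mu]_(t in `]y, z]) ((G z * f t + F y * g t) - (f t * G t + g t * F t)).
  rewrite RintegralB//; last 2 first.
  - by apply: S; apply: integrable_realD => //; exact: integrable_realZ.
  - by apply: S; exact: integrable_realD.
  congr (_ - _).
  rewrite RintegralD//; do ?[by apply: S => //; exact: integrable_realZ].
  rewrite !RintegralZl//; do ?[by apply: S].
  rewrite -(primitive_increment pF)// -(primitive_increment pG)//; ring.
rewrite E -RintegralZl//; last first.
  by apply: S; apply: integrable_realD => //; exact: integrable_norm.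
apply: le_normr_Rintegral_dominated => //.
- apply: S; apply: integrable_realB => //; apply: integrable_realD => //;
    exact: integrable_realZ.
- by apply: S; apply: integrable_realZ => //; apply: integrable_realD => //;
    exact: integrable_norm.
move=> t /=; rewrite in_itv/= => /andP[/ltW yt tz].
have [tab td td'] := inab t yt tz.
rewrite (_ : _ - _ = f t * (G z - G t) + g t * (F y - F t)); last by ring.
rewrite (le_trans (ler_normD _ _))// !normrM mulrDr [eps * _]mulrC
  [eps * _]mulrC.
by rewrite lerD// ler_wpM2l//;
  [exact: close dG _ _ _ _ _ _|exact: close dF _ _ _ _ _ _].
Qed.

(** The intermediate point stays in every ball containing both endpoints, in whichever order they
    come, so continuity of [f] at the centre controls the slope. *)
Lemma mean_value_ball (F f : R -> R) p d u v :
  (forall x, is_derive x 1 F (f x)) -> `|u - p| < d -> `|v - p| < d ->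
  exists2 w, `|w - p| < d & F v - F u = f w * (v - u).
Proof.
move=> dF; wlog uv : u v / u <= v.
  move=> H up vp; have [uv|/ltW vu] := leP u v; first exact: H.
  have [w wp E] := H _ _ vu vp up; exists w => //.
  by rewrite -opprB E; ring.
move=> up vp; have [w|w wuv E] := MVT_segment uv (fun x _ => dF x).
  by apply: derivable_within_continuous => x _; exact: ex_derive.
exists w => //; move: wuv; rewrite in_itv/= => /andP[? ?].
exact: between_dist_lt up vp.
Qed.

(** By the mean value theorem the increment of [p (F x)] is [q w (F z - F y)] with [w] close to
    [F x]; the error is the integral of [f (q w - q (F t))], at most [eps] times that of [|f|]. *)
Lemma is_primitive_comp a b f F (p q : R -> R) : a <= b ->
  is_primitive a b f F -> (forall x, is_derive x 1 p (q x)) -> continuous q ->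
  is_primitive a b (fun x => f x * q (F x)) (fun x => p (F x)).
Proof.
move=> ab pF dp qc; have [fi _] := pF.
have Fc := is_primitive_continuous ab pF.
have mab : measurable (`[a, b]%classic : set R) by [].
have qFc : {within `[a, b], continuous (q \o F)}.
  by apply: within_continuous_comp Fc => x _; exact: qc.
have fqi := integrableM_continuous fi qFc.
apply: (@is_primitive_loc _ _ _ _ _ (fun x => `|f x|)) => //.
  exact: integrable_norm.
move=> eps e0 x xab; have e20 : 0 < eps / 2 by rewrite divr_gt0.
have [r r0 qr] : exists2 r : R, 0 < r & forall u, `|u - F x| < r ->
  `|q u - q (F x)| < eps / 2.
  have /cvgrPdist_lt/(_ _ e20)[r /= r0 qr] := qc (F x).
  by exists r => // u ux; rewrite distrC qr//= distrC.
have [d d0 dF] := within_continuous_dist r0 xab Fc.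
exists d => // y z ay yz zb yd zd.
have inab t : y <= t -> t <= z -> `|F t - F x| < r.
  move=> yt tz; apply: dF.
    by rewrite /= in_itv/= (le_trans ay yt) (le_trans tz zb).
  exact: between_dist_lt yd zd.
have [w wr ->] := mean_value_ball dp (inab y (lexx _) yz) (inab z yz (lexx _)).
have S h : mu.-integrable `[a, b] (EFin \o h) ->
  mu.-integrable `]y, z] (EFin \o h).
  by move=> hi; apply: integrableS hi => //; exact: subset_itvoc_itvcc.
rewrite (primitive_increment pF)// -RintegralZl//; last exact: S.
rewrite -RintegralB//; last 2 first.
- by apply: S; exact: integrable_realZ.
- exact: S.
rewrite -RintegralZl//; last by apply: S; exact: integrable_norm.
apply: le_normr_Rintegral_dominated => //.
- by apply: S; apply: integrable_realB => //; exact: integrable_realZ.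
- by apply: S; apply: integrable_realZ => //; exact: integrable_norm.
move=> t /=; rewrite in_itv/= => /andP[/ltW yt tz].
rewrite (_ : _ - _ = f t * ((q w - q (F x)) - (q (F t) - q (F x))));
  last by ring.
rewrite normrM mulrC ler_wpM2r// (le_trans (ler_normB _ _))// [leRHS]splitr.
by rewrite lerD// ltW// qr// inab.
Qed.

Lemma is_primitive_id a b : is_primitive a b (cst 1) id.
Proof.
split.
  apply: continuous_compact_integrable; first exact: segment_compact.
  by apply: continuous_subspaceT => x; exact: cvg_cst.
move=> x; rewrite in_itv/= => /andP[ax _].
rewrite Rintegral_cst//= lebesgue_measure_itv/= lte_fin mul1r.
by case: ltgtP ax => //= [ax _|-> _]; [ring|rewrite addr0].
Qed.

(** The chain rule with the identity as inner function. *)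
Lemma is_primitive_C1 a b (p q : R -> R) : a <= b ->
  (forall x, is_derive x 1 p (q x)) -> continuous q -> is_primitive a b q p.
Proof.
move=> ab dp qc; have := is_primitive_comp ab (is_primitive_id a b) dp qc.
by under eq_fun do rewrite mul1r.
Qed.

Lemma is_primitive_cst a b c : a <= b -> is_primitive a b (cst 0) (cst c).
Proof.
move=> ab; apply: is_primitive_C1 => // x; exact: cvg_cst.
Qed.

End PrimitiveCalculus.

(** * Complex-valued primitives *)

Section ComplexPrimitives.
Context {R : realType}.
Implicit Types (a b x y : R) (f g F G : R -> R) (u v w U V W : R -> R[i]).
Local Notation mu := (@lebesgue_measure R).

Lemma is_primitive_ext a b f g F G : f =1 g -> F =1 G ->
  is_primitive a b f F -> is_primitive a b g G.
Proof. by move=> /funext -> /funext ->. Qed.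

Lemma is_primitiveB a b f F g G : is_primitive a b f F ->
  is_primitive a b g G ->
  is_primitive a b (fun x => f x - g x) (fun x => F x - G x).
Proof.
move=> pF /(is_primitiveZ (-1)) pG.
by apply: is_primitive_ext (is_primitiveD pF pG) => x; rewrite mulN1r.
Qed.

Definition is_cprimitive a b w W :=
  is_primitive a b (Re \o w) (Re \o W) /\ is_primitive a b (Im \o w) (Im \o W).

Definition cintegrable a b w :=
  mu.-integrable `[a, b] (EFin \o (Re \o w)) /\
  mu.-integrable `[a, b] (EFin \o (Im \o w)).

Lemma is_cprimitive_integrable a b w W : is_cprimitive a b w W ->
  cintegrable a b w.
Proof. by move=> [[? _] [? _]]. Qed.

Lemma is_cprimitiveE a b w W x : is_cprimitive a b w W -> x \in `[a, b] ->
  W x = W a + cint a x w.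
Proof.
move=> [[_ rW] [_ iW]] xab; have /= := rW x xab; have /= := iW x xab.
by rewrite /cint; case: (W x) (W a) => ? ? [? ?] /= -> ->.
Qed.

Lemma cint_is_cprimitive a b w : cintegrable a b w ->
  is_cprimitive a b w (fun x => cint a x w).
Proof.
by move=> [rw iw]; split; split=> // x xab;
  rewrite /= set_itv1 Rintegral_set1 add0r.
Qed.

Lemma is_cprimitive_continuous a b w W : a <= b -> is_cprimitive a b w W ->
  ccontinuous_on `[a, b] W.
Proof. by move=> ab [/(is_primitive_continuous ab) ? /(is_primitive_continuous
  ab)]. Qed.

Lemma is_cprimitive_ext a b v w V W : v =1 w -> V =1 W ->
  is_cprimitive a b v V -> is_cprimitive a b w W.
Proof. by move=> /funext -> /funext ->. Qed.

Lemma is_cprimitive_cst a b (c : R[i]) : a <= b ->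
  is_cprimitive a b (cst 0) (cst c).
Proof. by move=> ab; split; exact: is_primitive_cst. Qed.

Lemma is_cprimitiveD a b v V w W : is_cprimitive a b v V ->
  is_cprimitive a b w W ->
  is_cprimitive a b (fun x => v x + w x) (fun x => V x + W x).
Proof.
move=> [rV iV] [rW iW]; split.
- apply: is_primitive_ext (is_primitiveD rV rW) => x /=.
  + by case: (v x) (w x) => ? ? [].
  + by case: (V x) (W x) => ? ? [].
- apply: is_primitive_ext (is_primitiveD iV iW) => x /=.
  + by case: (v x) (w x) => ? ? [].
  + by case: (V x) (W x) => ? ? [].
Qed.

Lemma is_cprimitiveM a b v V w W : a <= b -> is_cprimitive a b v V ->
  is_cprimitive a b w W ->
  is_cprimitive a b (fun x => v x * W x + w x * V x) (fun x => V x * W x).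
Proof.
move=> ab [rV iV] [rW iW]; split.
- have P := is_primitiveB (is_primitiveM ab rV rW) (is_primitiveM ab iV iW).
  apply: is_primitive_ext P => x /=.
  + by case: (v x) (w x) (V x) (W x) => ? ? [? ?] [? ?] [? ?] /=; ring.
  + by case: (V x) (W x) => ? ? [].
- have P := is_primitiveD (is_primitiveM ab rV iW) (is_primitiveM ab iV rW).
  apply: is_primitive_ext P => x /=.
  + by case: (v x) (w x) (V x) (W x) => ? ? [? ?] [? ?] [? ?] /=; ring.
  + by case: (V x) (W x) => ? ? [].
Qed.

Lemma is_cprimitiveZ a b (c : R[i]) w W : a <= b -> is_cprimitive a b w W ->
  is_cprimitive a b (fun x => c * w x) (fun x => c * W x).
Proof.
move=> ab /(is_cprimitiveM ab (is_cprimitive_cst c ab)).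
by apply: is_cprimitive_ext => x //=; rewrite mul0r add0r mulrC.
Qed.

Lemma is_cprimitive_id a b : is_cprimitive a b (cst 1) (fun x => x%:C).
Proof.
split; first exact: is_primitive_id.
by have := is_primitiveB (is_primitive_id a b) (is_primitive_id a b);
   apply: is_primitive_ext => x /=; rewrite subrr.
Qed.

(** The parts of the exponential are [exp (Re W) cos (Im W)] and [exp (Re W) sin (Im W)]: the real
    chain rule handles each factor and the product rule combines them. *)
Lemma is_cprimitive_cexp a b w W : a <= b -> is_cprimitive a b w W ->
  is_cprimitive a b (fun x => w x * cexp (W x)) (fun x => cexp (W x)).
Proof.
move=> ab [rW iW].
have pE := is_primitive_comp ab rW (@is_derive_expR R) (@continuous_expR R).
have pS := is_primitive_comp ab iW (@is_derive_sin R) (@continuous_cos R).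
have cNS : continuous (fun x : R => - sin x).
  by move=> x; apply: cvgN; exact: continuous_sin.
have pC := is_primitive_comp ab iW (@is_derive_cos R) cNS.
split.
- apply: is_primitive_ext (is_primitiveM ab pE pC) => x /=.
  + by rewrite /cexp; case: (w x) (W x) => ? ? [? ?] /=; ring.
  + by rewrite /cexp; case: (W x) => ? ? /=; ring.
- apply: is_primitive_ext (is_primitiveM ab pE pS) => x /=.
  + by rewrite /cexp; case: (w x) (W x) => ? ? [? ?] /=; ring.
  + by rewrite /cexp; case: (W x) => ? ? /=; ring.
Qed.

Lemma cexpD (y z : R[i]) : cexp (y + z) = cexp y * cexp z.
Proof.
case: y z => a b [c d]; rewrite /cexp /= expRD cosD sinD.
by apply/eqP; rewrite eq_complex /=; apply/andP; split; apply/eqP; ring.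
Qed.

Lemma cexp0 : cexp 0 = 1 :> R[i].
Proof. by rewrite /cexp /= expR0 cos0 sin0 mul1r. Qed.

Lemma cexpNK (z : R[i]) : cexp (- z) * cexp z = 1.
Proof. by rewrite -cexpD addNr cexp0. Qed.

Lemma cexp_neq0 (z : R[i]) : cexp z != 0.
Proof.
by apply: contra_eq_neq (cexpNK z) => ->; rewrite mulr0 eq_sym oner_neq0.
Qed.

Lemma cexpN (z : R[i]) : cexp (- z) = (cexp z)^-1.
Proof. by apply: (mulIf (cexp_neq0 z)); rewrite cexpNK mulVf ?cexp_neq0. Qed.

Lemma cintegrableM_ccontinuous a b w W : cintegrable a b w ->
  ccontinuous_on `[a, b] W -> cintegrable a b (fun x => w x * W x).
Proof.
move=> [wr wi] [Wr Wi]; have mab : measurable (`[a, b]%classic : set R) by [].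
split.
- suff : mu.-integrable `[a, b] (EFin \o (fun x =>
      Re (w x) * Re (W x) - Im (w x) * Im (W x))).
    by congr (_.-integrable _ _); apply/funext => x /=;
      case: (w x) (W x) => ? ? [].
  by apply: integrable_realB => //; exact: integrableM_continuous.
- suff : mu.-integrable `[a, b] (EFin \o (fun x =>
      Re (w x) * Im (W x) + Im (w x) * Re (W x))).
    congr (_.-integrable _ _); apply/funext => x /=.
    by case: (w x) (W x) => ? ? [].
  by apply: integrable_realD => //; exact: integrableM_continuous.
Qed.

Lemma cintD a b v w : a <= b -> cintegrable a b v -> cintegrable a b w ->
  cint a b (fun x => v x + w x) = cint a b v + cint a b w.
Proof.
move=> ab /cint_is_cprimitive pv /cint_is_cprimitive pw.
have bab : b \in `[a, b] by rewrite in_itv/= ab lexx.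
have := is_cprimitiveE (is_cprimitiveD pv pw) bab.
have := is_cprimitiveE pv bab; have := is_cprimitiveE pw bab.
set va := cint a a v; set wa := cint a a w.
(* The primitive identity for [w] at [b] forces the integral over the single point [a] to vanish;
   likewise for [v]. *)
move=> /eqP; rewrite -subr_eq0 opprD addrCA subrr addr0 oppr_eq0 => /eqP ->.
move=> /eqP; rewrite -subr_eq0 opprD addrCA subrr addr0 oppr_eq0 => /eqP ->.
by rewrite !add0r => <-.
Qed.

Lemma cintZ a b (c : R[i]) w : a <= b -> cintegrable a b w ->
  cint a b (fun x => c * w x) = c * cint a b w.
Proof.
move=> ab /cint_is_cprimitive pw.
have bab : b \in `[a, b] by rewrite in_itv/= ab lexx.
have := is_cprimitiveE (is_cprimitiveZ c ab pw) bab.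
have := is_cprimitiveE pw bab; set wa := cint a a w.
move=> /eqP; rewrite -subr_eq0 opprD addrCA subrr addr0 oppr_eq0 => /eqP ->.
by rewrite mulr0 add0r => <-.
Qed.

Lemma cintegrableS a b x w : x \in `[a, b] -> cintegrable a b w ->
  cintegrable a x w.
Proof. by move=> xab [wr wi]; split; exact: integrable_itvcc_prefix xab _. Qed.

End ComplexPrimitives.

(** * Weak derivatives *)

Section AlmostEverywhere.
Context {R : realType}.
Implicit Types (a b c x y : R) (f g F G w : R -> R) (P : R -> Prop).
Local Notation mu := (@lebesgue_measure R).

Lemma ae_itvoo_itvcc a b P :
  (\forall x \ae mu, `]a, b[%classic x -> P x) ->
  \forall x \ae mu, `[a, b]%classic x -> P x.
Proof.
have ne c : \forall x \ae mu, x != c.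
  exists [set c]; split => //; first by rewrite lebesgue_measure_set1.
  by move=> x /= /negP; rewrite negbK => /eqP.
move=> aeP; near=> x; rewrite /= in_itv/= => /andP[ax xb].
have : `]a, b[%classic x -> P x by near: x.
apply; rewrite /= in_itv/= !lt_neqAle ax xb !andbT eq_sym.
by apply/andP; split; near: x; exact: ne.
Unshelve. all: by end_near. Qed.

Lemma ae_itvoo_exists a b P : a < b ->
  (\forall x \ae mu, `]a, b[%classic x -> P x) ->
  exists2 x, x \in `]a, b[ & P x.
Proof.
move=> ab [N [mN N0 PN]]; apply: contrapT => nP.
have sub : `]a, b[%classic `<=` N.
  by move=> x xab; apply: PN => /= /(_ xab) Px; apply: nP; exists x.
have : (mu `]a, b[ <= mu N)%E by apply: le_measure; rewrite ?inE.
by rewrite N0 lebesgue_measure_itv/= lte_fin ab lee_fin leNgt subr_gt0 ab.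
Qed.

Lemma continuous_ae_eq a b f g : a < b ->
  {within `[a, b], continuous f} -> {within `[a, b], continuous g} ->
  (\forall x \ae mu, `]a, b[%classic x -> f x = g x) ->
  {in `[a, b], f =1 g}.
Proof.
move=> ab fc gc fg x xab; apply/eqP; rewrite -subr_eq0; apply/negPn/negP => ne0.
have hc : {within `[a, b], continuous (f - g)} by exact: within_continuousB.
have h0 : 0 < `|(f - g) x| by rewrite normr_gt0.
have [d d0 dh] := within_continuous_dist h0 xab hc.
move: (xab); rewrite in_itv/= => /andP[ax xb].
(* Clipping keeps a nonempty open interval inside []a, b[] even when [x] is an endpoint; it has
   positive measure. *)
have lu : Num.max a (x - d) < Num.min b (x + d).
  by rewrite lt_min !gt_max ab /=; apply/and3P; split; lra.
have fg' : \forall y \ae mu,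
    `]Num.max a (x - d), Num.min b (x + d)[%classic y -> f y = g y.
  apply: filterS fg => y fgy /=; rewrite in_itv/= lt_min gt_max.
  by move=> /andP[/andP[ay _] /andP[yb _]]; apply: fgy; rewrite /= in_itv/= ay.
have [y] := ae_itvoo_exists lu fg';
  rewrite in_itv/= lt_min gt_max => /andP[/andP[ay xy] /andP[yb yx]] fgy.
have yx' : `|y - x| < d by rewrite ltr_distl xy yx.
have yab : y \in `[a, b] by rewrite in_itv/= !ltW.
by have := dh y yab yx'; rewrite !fctE fgy subrr sub0r normrN ltxx.
Qed.

(** At a Lebesgue point, [f] is the derivative of its indefinite integral, which is identically zero
    here. *)
Lemma is_primitive_cst_ae0 a b f F c : a < b -> is_primitive a b f F ->
  {in `[a, b], F =1 cst c} -> f = cst 0 %[ae mu in `]a, b[%classic].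
Proof.
move=> ab pF Fc; have [fi FE] := pF.
have mab : measurable (`[a, b]%classic : set R) by [].
have loc := integrable_locally mab fi.
have := lebesgue_differentiation loc; apply: filterS => x Lx.
rewrite /= in_itv/= => /andP[ax xb].
have hi : mu.-integrable [set` Interval (BLeft a) (BRight b)] (EFin \o f \_ `[a,
  b]).
  by rewrite -restrict_EFin; apply/integrable_restrict => //=; rewrite setIid.
have ax' : (BLeft a < BRight x)%E by rewrite lte_fin.
have [_] := FTC1_lebesgue_pt xb hi ax' Lx.
rewrite patchE mem_set/= ?in_itv/= ?(ltW ax) ?(ltW xb)// => <-.
(* Only the values near [x] count, and there the indefinite integral is zero. *)
rewrite derive1E (@near_eq_derive _ _ _ _ (cst 0)) ?derive_cst//.
near=> y.
have ay : a < y by near: y; exact: lt_nbhsr.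
have yb : y < b by near: y; exact: lt_nbhsl.
have yab : y \in `[a, b] by rewrite in_itv/= !ltW.
transitivity (\int[mu]_(t in `[a, y]) f t).
  apply: eq_Rintegral => t /[!inE]/=; rewrite in_itv/= => /andP[at' ty].
  by rewrite patchE mem_set//= in_itv/= at' (le_trans ty (ltW yb)).
have := FE y yab; rewrite !Fc ?in_itv/= ?lexx ?(ltW ab)//= => /eqP.
by rewrite -subr_eq0 opprD addrA subrr sub0r oppr_eq0 => /eqP.
Unshelve. all: by end_near. Qed.

End AlmostEverywhere.

(** * C^1 steps and the du Bois-Reymond lemma *)

Section DuBoisReymond.
Context {R : realType}.
Implicit Types (a b c d s t x y h : R) (f g F G w phi : R -> R).
Local Notation mu := (@lebesgue_measure R).

(** The difference quotient is within [c |h|] of [l]. For piecewise quadratic functions such a bound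
    is polynomial arithmetic, without treating the break points separately. *)
Lemma is_derive_quadratic F x l c :
  (forall h, `|F (x + h) - F x - h * l| <= c * h ^+ 2) -> is_derive x 1 F l.
Proof.
move=> Fq.
have c0 : 0 <= c by have := Fq 1; rewrite expr1n mulr1; exact: le_trans.
suff H : h^-1 *: ((F \o shift x) (h *: 1) - F x) @[h --> 0^'] --> l.
  by apply: DeriveDef; [apply/cvg_ex; exists l|apply/cvg_lim].
apply/cvgrPdist_le => /= e e0; near=> h.
have h0 : h != 0 by near: h; exact: nbhs_dnbhs_neq.
have hn : 0 < `|h| by rewrite normr_gt0.
have he : `|h| <= e / (c + 1).
  near: h; apply: dnbhs0_le; rewrite divr_gt0// ltr_wpDl//.
rewrite [X in `|X|](_ : _ = - (h^-1 * (F (x + h) - F x - h * l))); last first.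
  by rewrite /= scaler1 [h + x]addrC; rewrite /GRing.scale/=; field.
rewrite normrN normrM normfV mulrC ler_pdivrMr// (le_trans (Fq h))//.
rewrite -real_normK ?num_real// expr2 mulrA ler_wpM2r// .
rewrite (le_trans (ler_wpM2l c0 he))// mulrCA ler_piMr ?(ltW e0)//.
by rewrite ler_pdivrMr ?ltr_wpDl// mul1r lerDl.
Unshelve. all: by end_near. Qed.

(** A C^1 primitive of the positive part. *)
Definition half_square x := Num.max x 0 ^+ 2 / 2.

Lemma half_square_quadratic x h :
  `|half_square (x + h) - half_square x - h * Num.max x 0| <= 1 * h ^+ 2.
Proof.
rewrite /half_square mul1r ler_norml; case: (leP (x + h) 0);
  case: (leP x 0) => *;
  apply/andP; split; nra.
Qed.

(* Second differences turn [half_square] into a C^1 step from 0 to 1 on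
   [s, s + 2 d], whose derivative is a tent of mass 1. *)
Definition smooth_step d s x := d ^- 2 *
  (half_square (x - s) - 2 * half_square (x - s - d) + half_square (x - s - 2 *
    d)).

Definition tent d s x := d ^- 2 *
  (Num.max (x - s) 0 - 2 * Num.max (x - s - d) 0 + Num.max (x - s - 2 * d) 0).

(** The remainder is a second difference of remainders of [half_square]; its weights 1, 2, 1 add up
    to the constant 4. *)
Lemma smooth_step_quadratic d s x h :
  `|smooth_step d s (x + h) - smooth_step d s x - h * tent d s x| <=
  (4 * d ^- 2) * h ^+ 2.
Proof.
have d2 : 0 <= d ^- 2 by rewrite invr_ge0 sqr_ge0.
have H1 := half_square_quadratic (x - s) h.
have H2 := half_square_quadratic (x - s - d) h.
have H3 := half_square_quadratic (x - s - 2 * d) h.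
rewrite /smooth_step /tent !(addrAC x h).
rewrite (addrAC _ h (- d)) (addrAC _ h (- (2 * d))).
set q := half_square in H1 H2 H3 *.
rewrite [leRHS](_ : _ = d ^- 2 * (4 * h ^+ 2)); last by ring.
set A := (A in `|A| <= _).
have -> : A = d ^- 2 * (
    (q (x - s + h) - q (x - s) - h * Num.max (x - s) 0)
    - 2 * (q (x - s - d + h) - q (x - s - d) - h * Num.max (x - s - d) 0)
    + (q (x - s - 2 * d + h) - q (x - s - 2 * d) - h * Num.max (x - s - 2 * d)
        0)).
  by rewrite /A; ring.
rewrite normrM (ger0_norm d2) ler_wpM2l//.
by move: H1 H2 H3; rewrite !ler_norml => /andP[? ?] /andP[? ?] /andP[? ?];
  apply/andP; split; lra.
Qed.

Lemma tent_ge0 d s x : 0 < d -> 0 <= tent d s x.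
Proof.
move=> d0; rewrite /tent mulr_ge0 ?invr_ge0 ?sqr_ge0//.
by case: (leP (x - s) 0); case: (leP (x - s - d) 0);
  case: (leP (x - s - 2 * d) 0); lra.
Qed.

Lemma tent_le d s x : 0 < d -> tent d s x <= d^-1.
Proof.
move=> d0; rewrite /tent mulrC ler_pdivrMr ?exprn_gt0// expr2 mulKf ?gt_eqF//.
by case: (leP (x - s) 0); case: (leP (x - s - d) 0);
  case: (leP (x - s - 2 * d) 0); lra.
Qed.

Lemma tent_eq0 d s x : 0 < d -> ~~ (s < x < s + 2 * d) -> tent d s x = 0.
Proof.
move=> d0; rewrite negb_and -!leNgt => sx; rewrite /tent; apply/eqP;
  rewrite mulf_eq0; apply/orP; right; apply/eqP.
by case/orP: sx => ?; case: (leP (x - s) 0); case: (leP (x - s - d) 0);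
  case: (leP (x - s - 2 * d) 0); lra.
Qed.

Lemma smooth_step0 d s x : 0 < d -> x <= s -> smooth_step d s x = 0.
Proof.
move=> d0 xs; rewrite /smooth_step /half_square !max_r; [by ring|lra..].
Qed.

Lemma smooth_step1 d s x : 0 < d -> s + 2 * d <= x -> smooth_step d s x = 1.
Proof.
move=> d0 xs; rewrite /smooth_step /half_square !max_l; [|lra..].
by field; rewrite gt_eqF.
Qed.

Lemma continuous_tent d s : continuous (tent d s).
Proof.
have cm c : continuous (fun x => Num.max (x - c) 0).
  move=> x; apply: (@continuous_max _ _ (fun y => y - c) (cst 0)).
    by apply: cvgB; [exact: cvg_id|exact: cvg_cst].
  exact: cvg_cst.
move=> x; apply: cvgM; first exact: cvg_cst.
apply: cvgD.
  apply: cvgB; first exact: cm.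
  apply: cvgM; first exact: cvg_cst.
  by have := cm (s + d) x; under eq_fun do rewrite opprD addrA.
by have := cm (s + 2 * d) x; under eq_fun do rewrite opprD addrA.
Qed.

Lemma is_derive_smooth_step d s x : is_derive x 1 (smooth_step d s) (tent d s
  x).
Proof. exact: is_derive_quadratic (smooth_step_quadratic d s x). Qed.

(** A single step stays equal to 1 on the right; in the difference of two steps these plateaus
    cancel, which makes the support compact in []0, 2 pi[]. *)
Lemma test_function_smooth_stepB d s t : 0 < d -> 0 < s -> 0 < t ->
  s + 2 * d < 2 * pi -> t + 2 * d < 2 * pi ->
  test_function (fun x => smooth_step d s x - smooth_step d t x) /\
  derive1 (fun x => smooth_step d s x - smooth_step d t x) =
    (fun x => tent d s x - tent d t x).
Proof.
move=> d0 s0 t0 sd td.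
have D x : is_derive x 1 (fun x => smooth_step d s x - smooth_step d t x)
    (tent d s x - tent d t x).
  by have := is_deriveB (is_derive_smooth_step d s x) (is_derive_smooth_step d t
    x).
have DE : derive1 (fun x => smooth_step d s x - smooth_step d t x) =
    (fun x => tent d s x - tent d t x).
  by apply/funext => x; rewrite derive1E; apply: derive_val.
split => //; split.
- by move=> x; exact: ex_derive.
- by rewrite DE => x; apply: cvgB; exact: continuous_tent.
exists (Num.min s t), (Num.max s t + 2 * d); split.
- by rewrite lt_min s0.
- by rewrite -ltrBrDr gt_max !ltrBrDr sd.
move=> x; rewrite in_itv/= negb_and -!ltNge => /orP[].
  rewrite lt_min => /andP[/ltW xs /ltW xt].
  by rewrite !smooth_step0// subrr.
rewrite -ltrBrDr gt_max !ltrBrDr => /andP[/ltW xs /ltW xt].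
by rewrite !smooth_step1// subrr.
Qed.

(** Since the tent has mass 1, the difference is the integral of [(w - w s)] against the tent over
    the ball of radius [2 d]. The tent is at most [1 / d] and the ball has length [4 d], whence the
    factor 4. *)
Lemma tent_average w s d : mu.-integrable `[0, 2 * pi] (EFin \o w) -> 0 < d ->
  0 < s - 2 * d -> s + 2 * d < 2 * pi ->
  ((`|\int[mu]_(x in `[0, 2 * pi]) (w x * tent d s x) - w s|)%R%:E <=
    4%:E * davg (w \_ `[0, 2 * pi])%R s (2 * d)%R)%E.
Proof.
move=> wi d0 sd0 sd1; set W := w \_ _.
have pi20 : 0 <= 2 * pi :> R by rewrite mulr_ge0 ?pi_ge0.
have m0 : measurable (`[0, 2 * pi]%classic : set R) by [].
have mB : measurable (ball s (2 * d)) by exact: measurable_ball.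
have tc A : {within A, continuous (tent d s)}.
  by apply: continuous_subspaceT; exact: continuous_tent.
have ti : mu.-integrable `[0, 2 * pi] (EFin \o tent d s).
  by apply: continuous_compact_integrable (tc _); exact: segment_compact.
(* The mass is the total rise of the step, from 0 at the left end to 1 at the right end. *)
have t1 : \int[mu]_(x in `[0%R, 2 * pi]) tent d s x = 1.
  have [_ /(_ (2 * pi))] :=
    is_primitive_C1 pi20 (is_derive_smooth_step d s) (@continuous_tent d s).
  rewrite in_itv/= pi20 lexx => /(_ erefl).
  by rewrite smooth_step1 ?smooth_step0 ?add0r//; lra.
have wti : mu.-integrable `[0, 2 * pi] (EFin \o (fun x => w x * tent d s x)).
  exact: integrableM_continuous (tc _).
have sub x : ball s (2 * d) x -> `[0, 2 * pi]%classic x.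
  by rewrite /ball/= ltr_norml in_itv/= => /andP[? ?]; apply/andP; split; lra.
have Ws : W s = w s.
  by rewrite /W patchE mem_set//; apply: sub; rewrite /ball/= subrr normr0; lra.
have Wi : mu.-integrable (ball s (2 * d)) (EFin \o (fun x => W x - W s)).
  have : mu.-integrable (ball s (2 * d)) (EFin \o (fun x => w x - w s)).
    apply: integrableS (_ : mu.-integrable `[0, 2 * pi] _) => //.
    apply: integrable_realB => //.
    apply: continuous_compact_integrable; first exact: segment_compact.
    by apply: continuous_subspaceT => x; exact: cvg_cst.
  apply: eq_integrable => // x; rewrite inE => /sub xI.
  by rewrite /= Ws /W patchE mem_set.
have E : \int[mu]_(x in `[0%R, 2 * pi]) (w x * tent d s x) - w s =
    \int[mu]_(x in ball s (2 * d)) ((W x - W s) * tent d s x).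
  transitivity (\int[mu]_(x in `[0,
    2 * pi]) (w x * tent d s x - w s * tent d s x)).
    rewrite RintegralB//; last exact: integrable_realZ.
    by rewrite [in RHS]RintegralZl// t1 mulr1.
  rewrite Rintegral_mkcond [RHS]Rintegral_mkcond; apply: eq_Rintegral => x _.
  rewrite !patchE; have [xB|xB] := pselect (ball s (2 * d) x).
    have xI := sub x xB.
    by rewrite !mem_set// Ws /W patchE mem_set// mulrBl.
  rewrite [in RHS]memNset// tent_eq0// ?mulr0 ?subrr ?if_same//.
  apply/negP => /andP[sx xs]; apply: xB.
  by rewrite /ball/= ltr_norml; apply/andP; split; lra.
rewrite E /davg /iavg lebesgue_measure_ball ?mulr_ge0 ?(ltW d0)//.
have Wn := integrable_norm Wi.
have -> : (\int[mu]_(y in ball s (2 * d)) `|((center (W s) \o W) y)%:E|)%E =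
    (\int[mu]_(y in ball s (2 * d)) `|W y - W s|)%:E.
  by rewrite fineK//; apply: integrable_fin_num => //; exact: Wn.
have Kb : [bounded tent d s x | x in ball s (2 * d)].
  exists d^-1; split; first exact: num_real.
  by move=> M dM x _; rewrite /= ger0_norm ?tent_ge0// (le_trans (tent_le _ _
    _))// ltW.
have mK : measurable_fun (ball s (2 * d)) (tent d s).
  by apply: measurable_funTS; apply: continuous_measurable_fun;
    exact: continuous_tent.
rewrite inver gt_eqF; last by lra.
rewrite muleA -!EFinM lee_fin.
have -> : 4 * (2 * d *+ 2)^-1 = d^-1 by field; rewrite gt_eqF.
rewrite -RintegralZl//; apply: le_normr_Rintegral_dominated => //.
- exact: integrable_realM.
- exact: integrable_realZ.
- move=> x _; rewrite normrM mulrC ler_wpM2r//.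
  by rewrite ger0_norm ?tent_ge0// tent_le.
Qed.

Lemma lebesgue_pt_davg_lt w s (e : R) : 0 < e -> lebesgue_pt w s ->
  \forall r \near 0^'+, (davg w s r < e%:E)%E.
Proof.
move=> e0 ws; have e0' : (0 < e%:E)%E by rewrite lte_fin.
exact: (ws [set y | (y < e%:E)%E] (open_ereal_lt' e0')).
Qed.

(** The constant is the value at one fixed Lebesgue point [s]. Testing against the difference of the
    steps at [s] and at another Lebesgue point [t] equates the two tent averages of [w], which tend
    to [w s] and [w t]. *)
Lemma du_bois_reymond w : mu.-integrable `[0, 2 * pi] (EFin \o w) ->
  (forall phi, test_function phi ->
    \int[mu]_(x in `[0, 2 * pi]) (w x * derive1 phi x) = 0) ->
  exists c, \forall x \ae mu, `]0, 2 * pi[%classic x -> w x = c.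
Proof.
move=> wi w0.
have pi20 : 0 < 2 * pi :> R by rewrite mulr_gt0 ?pi_gt0.
have m0 : measurable (`[0, 2 * pi]%classic : set R) by [].
pose W := w \_ `[0, 2 * pi].
have aeL := lebesgue_differentiation (integrable_locally m0 wi).
have [s s02 sL] : exists2 s, s \in `]0, 2 * pi[ & lebesgue_pt W s.
  by apply: ae_itvoo_exists => //; apply: filterS aeL.
exists (w s); apply: filterS aeL => t tL; rewrite /= in_itv/= => /andP[t0 t2].
move: s02; rewrite in_itv/= => /andP[s0 s2].
apply/eqP; rewrite -subr_eq0 -normr_le0; apply/ler_addgt0Pl => e e0;
  rewrite addr0.
(* The factor 4 of [tent_average] turns [e / 8] into [e / 2] at each of the two points. *)
have e80 : 0 < e / 8 by rewrite divr_gt0.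
near (0 : R)^'+ => r.
have r0 : 0 < r by [].
(* The tents have parameter [r / 2], so that the averaging balls have radius [r]. *)
have [d0 E] : 0 < r / 2 /\ 2 * (r / 2) = r by split; [rewrite divr_gt0|field].
have ts x : 0 < x -> x < 2 * pi -> r < x -> r < 2 * pi - x ->
    (davg W x r < (e / 8)%:E)%E ->
    `|\int[mu]_(y in `[0, 2 * pi]) (w y * tent (r / 2) x y) - w x| <= e / 2.
  move=> x0 x2 rx rx2 dx; rewrite -lee_fin.
  have lo : 0 < x - 2 * (r / 2) by rewrite E subr_gt0.
  have hi : x + 2 * (r / 2) < 2 * pi by rewrite E -ltrBrDl.
  have H := tent_average wi d0 lo hi.
  rewrite (le_trans H)// E (@le_trans _ _ (4%:E * (e / 8)%:E)%E)//.
    by rewrite lee_pmul2l// ltW.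
  by rewrite -EFinM lee_fin; lra.
have rs : r < s by near: r; exact: nbhs_right_lt.
have rt : r < t by near: r; exact: nbhs_right_lt.
have rs2 : r < 2 * pi - s by near: r; apply: nbhs_right_lt; rewrite subr_gt0.
have rt2 : r < 2 * pi - t by near: r; apply: nbhs_right_lt; rewrite subr_gt0.
have Hs : (davg W s r < (e / 8)%:E)%E.
  by near: r; exact: lebesgue_pt_davg_lt.
have Ht : (davg W t r < (e / 8)%:E)%E.
  by near: r; exact: lebesgue_pt_davg_lt.
have {}Hs := ts s s0 s2 rs rs2 Hs; have {}Ht := ts t t0 t2 rt rt2 Ht.
have sd : s + 2 * (r / 2) < 2 * pi by rewrite E -ltrBrDl.
have td : t + 2 * (r / 2) < 2 * pi by rewrite E -ltrBrDl.
have [phiT phiE] := test_function_smooth_stepB d0 s0 t0 sd td.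
have wT x : mu.-integrable `[0, 2 * pi] (EFin \o (fun y =>
  w y * tent (r / 2) x y)).
  apply: integrableM_continuous => //.
  by apply: continuous_subspaceT; exact: continuous_tent.
have /eqP := w0 _ phiT; rewrite phiE.
under eq_Rintegral do rewrite mulrBr.
rewrite RintegralB// subr_eq0 => /eqP Est.
move: Hs Ht; rewrite Est !ler_norml => /andP[? ?] /andP[? ?]; apply/andP; split;
  lra.
Unshelve. all: by end_near. Qed.

End DuBoisReymond.

(** * Continuous representatives and weak derivatives of L^2 classes *)

Section L2Representatives.
Context {R : realType}.
Implicit Types (a b x : R) (f : R -> R) (u v w U V W : R -> R[i]).
Local Notation mu := (@lebesgue_measure R).

Lemma two_pi_gt0 : 0 < 2 * pi :> R.
Proof. by rewrite mulr_gt0 ?pi_gt0. Qed.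

(** Bridges the open interval [I2pi] and the closed intervals of [cint]; the endpoints are null. *)
Lemma integrable_itvoo_itvcc a b f : mu.-integrable `]a, b[ (EFin \o f) ->
  mu.-integrable `[a, b] (EFin \o f).
Proof.
move=> /integrableP[/measurable_EFinP mf fi]; apply/integrableP; split.
  by apply/measurable_EFinP; exact: measurable_fun_itv_cc mf.
rewrite integral_itv_bndoo//.
by apply/measurable_EFinP; apply: measurableT_comp.
Qed.

Lemma normr_Re_le_normc (z : R[i]) : `|Re z| <= normc z.
Proof.
by case: z => a b /=; rewrite -sqrtr_sqr ler_wsqrtr// lerDl sqr_ge0.
Qed.

Lemma normr_Im_le_normc (z : R[i]) : `|Im z| <= normc z.
Proof.
by case: z => a b /=; rewrite -sqrtr_sqr ler_wsqrtr// lerDr sqr_ge0.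
Qed.

Lemma normc_ge0 (z : R[i]) : 0 <= normc z.
Proof. by case: z => a b; exact: sqrtr_ge0. Qed.

Lemma normc_le_ReIm (z : R[i]) : normc z <= `|Re z| + `|Im z|.
Proof.
rewrite -(@ler_pXn2r _ 2) ?nnegrE ?normc_ge0 ?addr_ge0// normc_sqr sqrrD
  !real_normK ?num_real//.
by rewrite lerD2r lerDl mulrn_wge0// mulr_ge0.
Qed.

Lemma sub_I2pi : I2pi `<=` (`[0, 2 * pi]%classic : set R).
Proof. exact: subset_itv_oo_cc. Qed.

Lemma integrable_cst_I2pi (c : R) : mu.-integrable I2pi (EFin \o cst c).
Proof.
suff ci : mu.-integrable `[0, 2 * pi] (EFin \o (fun=> c)).
  by apply: integrableS ci => //; [exact: measurable_I2pi|exact: sub_I2pi].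
apply: continuous_compact_integrable; first exact: segment_compact.
by apply: continuous_subspaceT => x; exact: cvg_cst.
Qed.

Lemma cmeasurable_dominated_cintegrable u f : cmeasurable I2pi u ->
  mu.-integrable I2pi (EFin \o f) ->
  (\forall x \ae mu, I2pi x -> normc (u x) <= f x) ->
  cintegrable 0 (2 * pi) u.
Proof.
move=> [mr mi] fi uf; have mI := @measurable_I2pi R.
have H (g : R -> R) : measurable_fun I2pi g ->
  (forall x, `|g x| <= normc (u x)) ->
    mu.-integrable I2pi (EFin \o g).
  move=> mg gu; have mE : measurable_fun I2pi (EFin \o g) by
    exact/measurable_EFinP.
  apply/integrableP; split => //.
  move: fi => /integrableP[mf]; apply: le_lt_trans.
  apply: ae_ge0_le_integral => //.
  - by apply: measurableT_comp.
  - by apply: measurableT_comp.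
  by apply: filterS uf => x /[apply] ux;
    rewrite lee_fin (le_trans (gu x))// (le_trans ux)// ler_norm.
split; apply: integrable_itvoo_itvcc; apply: H => // x.
- exact: normr_Re_le_normc.
- exact: normr_Im_le_normc.
Qed.

(** On an interval of finite length, [|u| <= 1 + |u|^2] suffices. *)
Lemma square_integrable_cintegrable u : square_integrable u ->
  cintegrable 0 (2 * pi) u.
Proof.
move=> [mu' iu].
apply: (cmeasurable_dominated_cintegrable (f :=
  fun x => 1 + normc (u x) ^+ 2)) => //.
  apply: integrable_realD => //;
    [exact: measurable_I2pi|exact: integrable_cst_I2pi].
apply: aeW => x _; have := sqr_ge0 (normc (u x) - 1);
  have := sqr_ge0 (normc (u x)); nra.
Qed.

Lemma Linfty_cintegrable V : Linfty V -> cintegrable 0 (2 * pi) V.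
Proof.
move=> [mV [M VM]].
exact: (cmeasurable_dominated_cintegrable mV (integrable_cst_I2pi M)).
Qed.

Lemma ccontinuous_square_integrable W : ccontinuous_on `[0, 2 * pi] W ->
  square_integrable W.
Proof.
move=> [Wr Wi]; have m0 : measurable (`[0, 2 * pi]%classic : set R) by [].
split.
  split; apply: (measurable_funS m0 sub_I2pi);
    exact: subspace_continuous_measurable_fun.
under eq_fun do rewrite normc_sqr.
suff ci : mu.-integrable `[0, 2 * pi]
    (EFin \o (fun x => Re (W x) ^+ 2 + Im (W x) ^+ 2)).
  by apply: integrableS ci => //; [exact: measurable_I2pi|exact: sub_I2pi].
apply: integrable_realD => //.
  apply: (integrableM_continuous (f := Re \o W) _ Wr).
  by apply: continuous_compact_integrable Wr; exact: segment_compact.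
apply: (integrableM_continuous (f := Im \o W) _ Wi).
by apply: continuous_compact_integrable Wi; exact: segment_compact.
Qed.

Lemma eq_is_cprimitive v w V W : cmeasurable I2pi w ->
  v = w %[ae mu in I2pi] -> {in `[0, 2 * pi], V =1 W} ->
  is_cprimitive 0 (2 * pi) v V -> is_cprimitive 0 (2 * pi) w W.
Proof.
move=> [wr wi] /ae_itvoo_itvcc vw VW [rV iV]; split.
- apply: eq_is_primitive rV; first exact: measurable_fun_itv_cc wr.
  + by apply: filterS vw => x /[apply] /= ->.
  + by move=> x /VW /= ->.
- apply: eq_is_primitive iV; first exact: measurable_fun_itv_cc wi.
  + by apply: filterS vw => x /[apply] /= ->.
  + by move=> x /VW /= ->.
Qed.

Lemma ccontinuous_ae_eq u v : ccontinuous_on `[0, 2 * pi] u ->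
  ccontinuous_on `[0, 2 * pi] v -> u = v %[ae mu in I2pi] ->
  {in `[0, 2 * pi], u =1 v}.
Proof.
move=> [ur ui] [vr vi] uv x xI.
have /(_ x xI)/= r : {in `[0, 2 * pi], Re \o u =1 Re \o v}.
  by apply: continuous_ae_eq two_pi_gt0 _ _ _ => //;
    apply: filterS uv => y /[apply] /= ->.
have /(_ x xI)/= i : {in `[0, 2 * pi], Im \o u =1 Im \o v}.
  by apply: continuous_ae_eq two_pi_gt0 _ _ _ => //;
    apply: filterS uv => y /[apply] /= ->.
by apply/eqP; rewrite eq_complex r i !eqxx.
Qed.

(** Two continuous representatives agree on the whole closed interval, so the choice made by
    [pointwise] is harmless, also at the endpoints. *)
Lemma pointwise_continuous_representative (f : L2 R) u :
  is_continuous_representative f u -> {in `[0, 2 * pi], pointwise f =1 u}.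
Proof.
move=> fu; have [cp fp] : is_continuous_representative f (pointwise f).
  by rewrite /pointwise; case: xgetP => [p _ //|/(_ u)].
apply: ccontinuous_ae_eq cp fu.1 _; case: fu => _ fu.
by apply: filterS2 fp fu => x fp fu Ix; rewrite -fp// fu.
Qed.

Lemma Re_mulC (z : R[i]) (r : R) : Re (z * r%:C) = Re z * r.
Proof. by case: z => a b /=; rewrite mulr0 subr0. Qed.

Lemma Im_mulC (z : R[i]) (r : R) : Im (z * r%:C) = Im z * r.
Proof. by case: z => a b /=; rewrite mulr0 add0r. Qed.

Lemma Re_cint a b w : Re (cint a b w) = \int[mu]_(x in `[a, b]) Re (w x).
Proof. by []. Qed.

Lemma Im_cint a b w : Im (cint a b w) = \int[mu]_(x in `[a, b]) Im (w x).
Proof. by []. Qed.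

Lemma cint_pt a w : cint a a w = 0.
Proof. by rewrite /cint set_itv1 !Rintegral_set1. Qed.

Lemma eq_cint v w x : cmeasurable I2pi w -> cintegrable 0 (2 * pi) v ->
  v = w %[ae mu in I2pi] -> x \in `[0, 2 * pi] -> cint 0 x v = cint 0 x w.
Proof.
move=> mw /cint_is_cprimitive pv vw xI.
have /is_cprimitiveE/(_ xI) := eq_is_cprimitive mw vw (fun _ _ => erefl) pv.
by rewrite cint_pt add0r.
Qed.

Lemma test_function_cprimitive phi : test_function phi ->
  is_cprimitive 0 (2 * pi) (fun x => (derive1 phi x)%:C) (fun x => (phi x)%:C).
Proof.
have pi20 := ltW two_pi_gt0.
move=> [dphi cphi _]; split; last exact: is_primitive_cst.
by apply: is_primitive_C1 => // x; rewrite /= derive1E; exact: derivableP.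
Qed.

(** Integration by parts from the product rule; the boundary terms vanish because the support of
    [phi] avoids both endpoints. *)
Lemma is_cprimitive_test v V phi : is_cprimitive 0 (2 * pi) v V ->
  test_function phi ->
  cint 0 (2 * pi) (fun x => V x * (derive1 phi x)%:C) =
  - cint 0 (2 * pi) (fun x => v x * (phi x)%:C).
Proof.
move=> vV tphi; have pC := test_function_cprimitive tphi.
have [_ _ [a [b [a0 b2 phi0]]]] := tphi.
have pi20 := ltW two_pi_gt0.
have zero x : x \notin `[a, b] -> (phi x)%:C = 0 by move=> /phi0 ->.
have piI : 2 * pi \in `[0, 2 * pi :> R] by rewrite in_itv/= pi20 lexx.
have := is_cprimitiveE (is_cprimitiveM pi20 vV pC) piI.
rewrite !zero ?in_itv/=; last 2 first.
- by rewrite leNgt a0.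
- by rewrite [_ <= b]leNgt b2 andbF.
have iv := is_cprimitive_integrable vV.
have iphi := is_cprimitive_integrable pC.
rewrite cintD//; last 2 first.
- exact: cintegrableM_ccontinuous (is_cprimitive_continuous pi20 pC).
- exact: cintegrableM_ccontinuous (is_cprimitive_continuous pi20 vV).
rewrite !mulr0 add0r => /esym/eqP; rewrite addr_eq0 => /eqP ->; rewrite opprK.
by under eq_fun do rewrite mulrC.
Qed.

(** Right to left is integration by parts. Left to right, [f] and the primitive of [g] from 0 have
    the same integrals against every [phi']; du Bois-Reymond, applied to real and imaginary parts,
    makes them differ by a constant. *)
Lemma weak_derivativeP (f g : L2 R) : is_weak_derivative f g <->
  exists2 W, is_cprimitive 0 (2 * pi) g W & (f : R ->
    R[i]) = W %[ae mu in I2pi].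
Proof.
have pi20 := ltW two_pi_gt0.
have piI : 2 * pi \in `[0, 2 * pi :> R] by rewrite in_itv/= pi20 lexx.
have gi := square_integrable_cintegrable (L2_fun_square_integrable g).
have [fr fi] := square_integrable_cintegrable (L2_fun_square_integrable f).
split=> [fg|[W gW fW] phi tphi]; last first.
  have [_ cphi _] := tphi; have pC := test_function_cprimitive tphi.
  rewrite -(is_cprimitive_test gW tphi); apply/esym/eq_cint => //.
  - apply: cmeasurableM; first exact: (L2_fun_square_integrable f).1.
    split; last exact: measurable_cst.
    by apply: measurable_funTS; exact: continuous_measurable_fun.
  - under eq_fun do rewrite mulrC.
    apply: cintegrableM_ccontinuous (is_cprimitive_continuous pi20 gW).
    exact: is_cprimitive_integrable pC.
  - by apply: filterS fW => x /[apply] ->.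
pose W0 x := cint 0 x g.
have gW0 : is_cprimitive 0 (2 * pi) g W0 by exact: cint_is_cprimitive.
have [Wr Wi] := is_cprimitive_continuous pi20 gW0.
have m0 : measurable (`[0, 2 * pi]%classic : set R) by [].
have ci (F : R -> R) : {within `[0, 2 * pi], continuous F} ->
    mu.-integrable `[0, 2 * pi] (EFin \o F).
  by apply: continuous_compact_integrable; exact: segment_compact.
have H (F G : R -> R) : mu.-integrable `[0, 2 * pi] (EFin \o F) ->
    {within `[0, 2 * pi], continuous G} ->
    (forall phi, test_function phi ->
      \int[mu]_(x in `[0, 2 * pi]) (F x * derive1 phi x) =
      \int[mu]_(x in `[0, 2 * pi]) (G x * derive1 phi x)) ->
    exists c, \forall x \ae mu, I2pi x -> F x = G x + c.
  move=> Fi Gc FG.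
  suff [c FGc] : exists c, \forall x \ae mu, I2pi x -> F x - G x = c.
    by exists c; apply: filterS FGc => x /[apply] <-; rewrite addrC subrK.
  apply: du_bois_reymond; first by apply: integrable_realB => //; exact: ci.
  move=> phi tphi; have [_ cphi _] := tphi.
  have phic : {within `[0, 2 * pi],
    continuous (derive1 phi)} by exact: continuous_subspaceT.
  under eq_Rintegral do rewrite mulrBl.
  rewrite RintegralB// ?FG ?subrr//; first exact: integrableM_continuous.
  by apply: integrableM_continuous phic; exact: ci.
have fW0 phi : test_function phi ->
    cint 0 (2 * pi) (fun x => f x * (derive1 phi x)%:C) =
    cint 0 (2 * pi) (fun x => W0 x * (derive1 phi x)%:C).
  by move=> tphi; rewrite fg// (is_cprimitive_test gW0).
have [cr Hr] : exists c, \forall x \ae mu, I2pi x -> Re (f x) = Re (W0 x) + c.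
  apply: H => // phi /fW0/(congr1 (@complex.Re _)); rewrite !Re_cint.
  under eq_Rintegral do rewrite Re_mulC.
  by under [in RHS]eq_Rintegral do rewrite Re_mulC.
have [ci' Hi] : exists c, \forall x \ae mu, I2pi x -> Im (f x) = Im (W0 x) + c.
  apply: H => // phi /fW0/(congr1 (@complex.Im _)); rewrite !Im_cint.
  under eq_Rintegral do rewrite Im_mulC.
  by under [in RHS]eq_Rintegral do rewrite Im_mulC.
exists (fun x => W0 x + (cr +i* ci')).
  have := is_cprimitiveD gW0 (is_cprimitive_cst (cr +i* ci') pi20).
  by apply: is_cprimitive_ext => x //=; rewrite addr0.
apply: filterS2 Hr Hi => x Hr Hi Ix; apply/eqP; rewrite eq_complex.
by move: (Hr Ix) (Hi Ix); case: (W0 x) => ? ? /= -> ->; rewrite !eqxx.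
Qed.

(** The primitives of [g] and [h] both represent [f], hence coincide by continuity; a zero primitive
    has density zero almost everywhere. *)
Lemma weak_derivative_unique (f g h : L2 R) : is_weak_derivative f g ->
  is_weak_derivative f h -> g = h.
Proof.
have pi20 := ltW two_pi_gt0.
move=> /weak_derivativeP[W gW fW] /weak_derivativeP[U hU fU].
have WU : {in `[0, 2 * pi], W =1 U}.
  apply: ccontinuous_ae_eq.
  - exact: is_cprimitive_continuous gW.
  - exact: is_cprimitive_continuous hU.
  - by apply: filterS2 fW fU => x fW fU Ix; rewrite -fW// fU.
case: gW hU => [gr gi] [hr hi]; apply/L2_eqP.
have r : {in `[0, 2 * pi], (fun x => (Re \o W) x - (Re \o U) x) =1 cst 0}.
  by move=> x xI; rewrite /= WU// subrr.
have i : {in `[0, 2 * pi], (fun x => (Im \o W) x - (Im \o U) x) =1 cst 0}.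
  by move=> x xI; rewrite /= WU// subrr.
have {}r := is_primitive_cst_ae0 two_pi_gt0 (is_primitiveB gr hr) r.
have {}i := is_primitive_cst_ae0 two_pi_gt0 (is_primitiveB gi hi) i.
apply: filterS2 r i => x r i Ix.
apply/eqP; rewrite eq_complex -subr_eq0 -[X in _ && X]subr_eq0.
by move: (r Ix) (i Ix) => /= -> ->; rewrite !eqxx.
Qed.

Lemma weak_derivativeE (f g : L2 R) : is_weak_derivative f g ->
  weak_derivative f = g.
Proof.
move=> fg; have wf : is_weak_derivative f (weak_derivative f).
  by rewrite /weak_derivative; case: xgetP => [h _ //|/(_ g)].
exact: weak_derivative_unique wf fg.
Qed.

End L2Representatives.

(** * Norm estimates *)

Section L2Bounds.
Context {R : realType}.
Implicit Types (x : R) (f g : L2 R) (u v w U W : R -> R[i]).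
Local Notation mu := (@lebesgue_measure R).
Local Notation T := (2 * pi : R).
Let pi20 : 0 <= T := ltW two_pi_gt0.

Lemma ccontinuous_bounded W : ccontinuous_on `[0, T] W ->
  exists2 K, 0 <= K & forall x, x \in `[0, T] -> normc (W x) <= K.
Proof.
move=> [Wr Wi].
have H (F : R -> R) : {within `[0, T], continuous F} ->
    exists2 K, 0 <= K & forall x, x \in `[0, T] -> `|F x| <= K.
  move=> Fc; have := compact_bounded (continuous_compact Fc (@segment_compact _
    0 T)).
  move=> [M [_ FM]]; exists (`|M| + 1); first by rewrite addr_ge0.
  by move=> x xI; apply: (FM _ (le_lt_trans (ler_norm M) _));
    [rewrite ltrDl|exists x].
have [K1 K10 W1] := H _ Wr; have [K2 K20 W2] := H _ Wi.
exists (K1 + K2); first exact: addr_ge0.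
move=> x xI; rewrite (le_trans (normc_le_ReIm _))//.
by rewrite lerD//; [exact: W1|exact: W2].
Qed.

Lemma L2norm_ge0 g : 0 <= L2norm g.
Proof. exact: sqrtr_ge0. Qed.

(* Minimising [|a| <= t / 2 + a ^ 2 / (2 t)] over [t > 0] replaces the
   Cauchy-Schwarz inequality. *)
Lemma L1_le_L2norm g :
  \int[mu]_(x in `[0, T]) (`|Re (g x)| + `|Im (g x)|) <= (T + 1) * L2norm g.
Proof.
have [gr gi] := square_integrable_cintegrable (L2_fun_square_integrable g).
have [mg g2] := L2_fun_square_integrable g.
have m0 : measurable (`[0, T]%classic : set R) by [].
have g2' : mu.-integrable `[0, T] (EFin \o (fun x => normc (g x) ^+ 2)).
  exact: integrable_itvoo_itvcc.
have N2 : \int[mu]_(x in `[0, T]) (normc (g x) ^+ 2) = L2norm g ^+ 2.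
  rewrite /L2norm sqr_sqrtr; last by apply: Rintegral_ge0 => x _;
    exact: sqr_ge0.
  rewrite /Rintegral integral_itv_bndoo//.
  by apply/measurable_EFinP; exact: measurable_normc_sqr.
have T0 : 0 < T + 1 by rewrite ltr_wpDl.
apply/ler_addgt0Pr => e e0.
(* Close to the optimal [t = L2norm g], but positive even when [g = 0]. *)
pose t := L2norm g + e / (T + 1).
have t0 : 0 < t by rewrite ltr_wpDl ?L2norm_ge0// divr_gt0.
have -> : (T + 1) * L2norm g + e = (T + 1) * t.
  by rewrite /t [RHS]mulrDr [_ * (e / _)]mulrC divfK// gt_eqF.
have ti : mu.-integrable `[0, T] (EFin \o (fun=> t)).
  apply: continuous_compact_integrable; first exact: segment_compact.
  by apply: continuous_subspaceT => x; exact: cvg_cst.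
apply: (@le_trans _ _ (\int[mu]_(x in `[0,
  T]) (t + (2 * t)^-1 * normc (g x) ^+ 2))).
  apply: le_Rintegral => //.
  - by apply: integrable_realD => //; exact: integrable_norm.
  - by apply: integrable_realD => //; exact: integrable_realZ.
  move=> x _; rewrite normc_sqr -[Re _ ^+ 2]real_normK ?num_real//.
  rewrite -[Im _ ^+ 2]real_normK ?num_real//.
  rewrite mulrC -lerBlDl ler_pdivlMr ?mulr_gt0//.
  rewrite -subr_ge0 (_ : _ - _ =
    (`|Re (g x)| - t) ^+ 2 + (`|Im (g x)| - t) ^+ 2).
    by rewrite addr_ge0 ?sqr_ge0.
  by ring.
rewrite RintegralD//; last exact: integrable_realZ.
rewrite RintegralZl// N2 Rintegral_cst//= lebesgue_measure_itv/= lte_fin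
  two_pi_gt0/= subr0.
rewrite [leRHS]mulrDl mul1r [t * _]mulrC lerD2l mulrC ler_pdivrMr ?mulr_gt0//.
have Nt : L2norm g <= t by rewrite lerDl divr_ge0 ?ltW.
rewrite (@le_trans _ _ (t ^+ 2)) ?ler_pXn2r ?nnegrE ?L2norm_ge0 ?(ltW t0)//.
by rewrite mulrCA -expr2 ler_peMl ?sqr_ge0// ler1n.
Qed.

(** Real and imaginary parts are bounded separately, whence the factor 2; enlarging [[0, x]] to the
    full interval makes the bound uniform in [x]. *)
Lemma normc_cintM_le u g (K : R) x : 0 <= K ->
  (forall t, t \in `[0, T] -> normc (u t) <= K) ->
  cintegrable 0 T (fun t => u t * g t) -> x \in `[0, T] ->
  normc (cint 0 x (fun t => u t * g t)) <= 2 * K * (T + 1) * L2norm g.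
Proof.
move=> K0 uK [ugr ugi] xI.
have /andP[x0 xT] : 0 <= x <= T by move: xI; rewrite in_itv.
have [gr gi] := square_integrable_cintegrable (L2_fun_square_integrable g).
have m0 : measurable (`[0, T]%classic : set R) by [].
pose h t := `|Re (g t)| + `|Im (g t)|.
have hi : mu.-integrable `[0, T] (EFin \o h).
  by apply: integrable_realD => //; exact: integrable_norm.
have Khi : mu.-integrable `[0, T] (EFin \o (fun t => K * h t)).
  exact: integrable_realZ.
have H (F : R -> R) : mu.-integrable `[0, T] (EFin \o F) ->
    (forall t, `|F t| <= normc (u t * g t)) ->
    `|\int[mu]_(t in `[0, x]) F t| <= K * ((T + 1) * L2norm g).
  move=> Fi Fug; apply: (@le_trans _ _ (\int[mu]_(t in `[0, x]) (K * h t))).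
    apply: le_normr_Rintegral_dominated => //;
      do ?exact: integrable_itvcc_prefix xI _.
    move=> t /=; rewrite in_itv/= => /andP[t0 tx].
    rewrite (le_trans (Fug t))// normcM ler_pM ?normc_ge0//.
      by rewrite uK// in_itv/= t0 (le_trans tx).
    exact: normc_le_ReIm.
  apply: (@le_trans _ _ (\int[mu]_(t in `[0, T]) (K * h t))).
    rewrite [leRHS](@Rintegral_itvcc_split _ _ 0 x)// lerDl.
    by apply: Rintegral_ge0 => t _; rewrite mulr_ge0// addr_ge0.
  by rewrite RintegralZl// ler_wpM2l// L1_le_L2norm.
apply: le_trans (normc_le_ReIm _) _.
have -> : 2 * K * (T + 1) * L2norm g =
  K * ((T + 1) * L2norm g) + K * ((T + 1) * L2norm g) by ring.
rewrite Re_cint Im_cint; apply: lerD; apply: H => // t.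
- exact: normr_Re_le_normc.
- exact: normr_Im_le_normc.
Qed.

Lemma L2norm_le_bound f (B : R) : 0 <= B ->
  (\forall x \ae mu, I2pi x -> normc (f x) <= B) ->
  L2norm f <= Num.sqrt T * B.
Proof.
move=> B0 fB; have [mf f2] := L2_fun_square_integrable f.
have mI := @measurable_I2pi R.
rewrite -[leRHS]ger0_norm ?mulr_ge0 ?sqrtr_ge0// -sqrtr_sqr.
rewrite ler_sqrt ?sqr_ge0// exprMn sqr_sqrtr//.
have -> : T * B ^+ 2 = \int[mu]_(x in I2pi) (B ^+ 2).
  rewrite Rintegral_cst//= /I2pi lebesgue_measure_itv/= lte_fin two_pi_gt0/=
    subr0.
  by rewrite mulrC.
have Bi : mu.-integrable I2pi (EFin \o (fun=> B ^+ 2)) by exact: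
  integrable_cst_I2pi.
apply: fine_le; [exact: integrable_fin_num|exact: integrable_fin_num|].
apply: ae_ge0_le_integral => //.
- by move=> x _; rewrite lee_fin sqr_ge0.
- by apply/measurable_EFinP; exact: measurable_normc_sqr.
- by move=> x _; rewrite lee_fin sqr_ge0.
apply: filterS fB => x /[apply] fB.
by rewrite lee_fin ler_pXn2r ?nnegrE ?normc_ge0.
Qed.

End L2Bounds.

(** * The resolvent equation *)

Section Definitions.
Context {R : realType}.
Implicit Types (V W : R -> R[i]) (k g : L2 R) (lambda c : R[i]) (x : R).

(* The right-hand side of the equation [W' = ...] obtained by solving
   [i W' + (V - lambda) W + c k = g] for [W']. *)
Definition ode_rhs V k lambda g c W x : R[i] :=
  'i%C * ((V x - lambda) * W x + c * k x - g x).

(** Divided by [I_exp], this is the solution for [g = 0] and [c = 1] that starts at [rho]. *)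
Definition eigen_factor V (rho : R[i]) k lambda x : R[i] :=
  rho + 'i%C * cint 0 x (fun t => I_exp V lambda t * k t).

(** It vanishes exactly when that solution takes the value 1 at [2 * pi]. *)
Definition char_fun V (rho : R[i]) k lambda : R[i] :=
  I_exp V lambda (2 * pi) - eigen_factor V rho k lambda (2 * pi).

(* The parameter [c] stands for the value of the solution at [2 pi]. *)
Definition shift_solution V (rho : R[i]) k lambda g c x : R[i] :=
  (I_exp V lambda x)^-1 * (c * eigen_factor V rho k lambda x -
    'i%C * cint 0 x (fun t => I_exp V lambda t * g t)).

End Definitions.

Section ResolventEquation.
Context {R : realType}.
Variables (V : R -> R[i]) (rho : R[i]) (k : L2 R).
Hypothesis hV : Linfty V.
Implicit Types (x : R) (f g : L2 R) (u v w U W : R -> R[i]) (lambda c d : R[i]).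
Local Notation mu := (@lebesgue_measure R).
Local Notation T := (2 * pi : R).
Let pi20 : 0 <= T := ltW two_pi_gt0.

Let zeroI : 0 \in `[0, T]. Proof. by rewrite in_itv/= lexx. Qed.
Let piI : T \in `[0, T]. Proof. by rewrite in_itv/= lexx pi20. Qed.

Lemma cmeasurableB u v : cmeasurable I2pi u -> cmeasurable I2pi v ->
  cmeasurable I2pi (fun x => u x - v x).
Proof.
move=> mu' mv; have := cmeasurableZD (-1) mv mu'.
by congr cmeasurable; apply/funext => x; rewrite !fctE scaleN1r addrC.
Qed.

Lemma cmeasurableD u v : cmeasurable I2pi u -> cmeasurable I2pi v ->
  cmeasurable I2pi (fun x => u x + v x).
Proof.
move=> mu' mv; have := cmeasurableZD 1 mu' mv.
by congr cmeasurable; apply/funext => x; rewrite !fctE scale1r.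
Qed.

Lemma cmeasurable_cst c : cmeasurable I2pi (cst c : R -> R[i]).
Proof. by split; exact: measurable_cst. Qed.

Lemma L2_cmeasurable f : cmeasurable I2pi f.
Proof. exact: (L2_fun_square_integrable f).1. Qed.

Local Notation ode := (ode_rhs V k).
Local Notation m := (eigen_factor V rho k).
Local Notation D := (char_fun V rho k).
Local Notation sol := (shift_solution V rho k).
Local Notation A := (A_op V rho k).

Local Notation "u =ae v" := ((u : R -> R[i]) = v %[ae mu in I2pi]) (at level 70).

(** * From the operator equation to an integral equation *)

Lemma L2_ode_rhs lambda f g c W : (f : R -> R[i]) = W %[ae mu in I2pi] ->
  ('i%C *: (toL2 (fun x => V x * f x) + c *: k - lambda *: f - g) : L2 R)
  =ae ode lambda g c W.
Proof.
(* Differences become sums of multiples, to which [L2_funD] and [L2_funZ] apply. *)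
rewrite -scaleNr -(scaleN1r g).
move=> fW; near=> x => Ix.
set F := toL2 _.
have e0 : F x = V x * f x by move: Ix; near: x; exact: toL2_Linfty_mulE.
have e1 : ('i%C *: (F + c *: k + (- lambda) *: f + (-1) *: g) : L2 R) x =
   'i%C * (F + c *: k + (- lambda) *: f + (-1) *: g : L2 R) x.
  by move: Ix; near: x; exact: L2_funZ.
have e2 : (F + c *: k + (- lambda) *: f + (-1) *: g : L2 R) x =
    (F + c *: k + (- lambda) *: f : L2 R) x + ((-1) *: g : L2 R) x.
  by move: Ix; near: x; exact: L2_funD.
have e3 : (F + c *: k + (- lambda) *: f : L2 R) x =
    (F + c *: k : L2 R) x + ((- lambda) *: f : L2 R) x.
  by move: Ix; near: x; exact: L2_funD.
have e4 : (F + c *: k : L2 R) x = F x + (c *: k : L2 R) x.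
  by move: Ix; near: x; exact: L2_funD.
have e5 : (c *: k : L2 R) x = c * k x by move: Ix; near: x; exact: L2_funZ.
have e6 : ((- lambda) *: f : L2 R) x = - lambda * f x.
  by move: Ix; near: x; exact: L2_funZ.
have e7 : ((-1) *: g : L2 R) x = -1 * g x by move: Ix; near: x; exact: L2_funZ.
have e8 : f x = W x by move: Ix; near: x.
by rewrite e1 e2 e3 e4 e5 e6 e7 e0 e8 /ode_rhs; ring.
Unshelve. all: by end_near. Qed.

Lemma solve_derivative (q F K L g : L2 R) :
  'i%C *: q + F + K - L = g <-> q = 'i%C *: (F + K - L - g).
Proof.
have -> : 'i%C *: q + F + K - L = 'i%C *: q + (F + K - L) by rewrite !addrA.
split=> [<-|->].
  rewrite opprD addrCA subrr addr0 scalerN scalerA -expr2 sqr_i.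
  by rewrite scaleN1r opprK.
by rewrite scalerA -expr2 sqr_i scaleN1r opprB subrK.
Qed.

(** The class [f] is traded for its absolutely continuous representative [W]: the boundary condition
    and the coefficient of [k] become genuine values of [W], and the equation is solved for the
    derivative. *)
Lemma shift_relP lambda f g : shift_rel (A_op V rho k) lambda f g <->
  exists W, [/\ is_cprimitive 0 T (ode lambda g (W T) W) W,
                (f : R -> R[i]) = W %[ae mu in I2pi] & W 0 = rho * W T].
Proof.
split.
  move=> [[[q fq] f0]] /=; rewrite (weak_derivativeE fq).
  have /weak_derivativeP[W qW fW] := fq.
  have Wc := is_cprimitive_continuous pi20 qW.
  have fp := pointwise_continuous_representative (conj Wc fW).
  rewrite fp// => E; exists W; split => //; last by rewrite -!fp.
  have qE := (solve_derivative _ _ _ _ _).1 E.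
  apply: eq_is_cprimitive qW => //; last first.
    by rewrite qE; exact: L2_ode_rhs.
  apply: cmeasurableM; first exact: cmeasurable_cst.
  apply: cmeasurableB; last exact: L2_cmeasurable.
  apply: cmeasurableD; apply: cmeasurableM.
  - by apply: cmeasurableB; [exact: hV.1|exact: cmeasurable_cst].
  - by have [] := ccontinuous_square_integrable Wc.
  - exact: cmeasurable_cst.
  - exact: L2_cmeasurable.
move=> [W [pW fW W0]].
have Wc := is_cprimitive_continuous pi20 pW.
have fp := pointwise_continuous_representative (conj Wc fW).
pose q : L2 R := 'i%C *: (toL2 (fun x =>
  V x * f x) + W T *: k - lambda *: f - g).
have fq : is_weak_derivative f q.
  apply/weak_derivativeP; exists W => //.
  apply: eq_is_cprimitive pW => //; first exact: L2_cmeasurable.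
  by have := L2_ode_rhs lambda g (W T) fW; apply: filterS => x /[apply].
split; first by split; [exists q|rewrite !fp].
rewrite /= (weak_derivativeE fq) fp//.
exact: (solve_derivative _ _ _ _ _).2.
Qed.


(** * Solution by the integrating factor *)

Local Notation I := (I_exp V).

Lemma I_exp_neq0 lambda x : I lambda x != 0.
Proof. exact: cexp_neq0. Qed.

Lemma I_exp0 lambda : I lambda 0 = 1.
Proof. by rewrite /I_exp cint_pt !mulr0 addr0 cexp0. Qed.

Lemma I_exp_cprimitive lambda :
  is_cprimitive 0 T (fun x => 'i%C * (lambda - V x) * I lambda x) (I lambda).
Proof.
have pV := is_cprimitiveZ (- 'i%C) pi20 (cint_is_cprimitive (Linfty_cintegrable
  hV)).
have pl := is_cprimitiveZ ('i%C * lambda) pi20 (@is_cprimitive_id R 0 T).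
apply: is_cprimitive_ext (is_cprimitive_cexp pi20 (is_cprimitiveD pV pl)) =>
  x //=.
by congr (_ * _); ring.
Qed.

Lemma I_exp_inv_cprimitive lambda :
  is_cprimitive 0 T (fun x => 'i%C * (V x - lambda) * (I lambda x)^-1)
    (fun x => (I lambda x)^-1).
Proof.
have pV := is_cprimitiveZ 'i%C pi20 (cint_is_cprimitive (Linfty_cintegrable
  hV)).
have pl := is_cprimitiveZ (- ('i%C * lambda)) pi20 (@is_cprimitive_id R 0 T).
have E x : cexp ('i%C * cint 0 x V + - ('i%C * lambda) * x%:C) =
  (I lambda x)^-1.
  by rewrite /I_exp -cexpN; congr cexp; ring.
apply: is_cprimitive_ext (is_cprimitive_cexp pi20 (is_cprimitiveD pV pl)) =>
  x //=.
by rewrite E; congr (_ * _); ring.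
Qed.

Lemma cintegrable_I_expM lambda f :
  cintegrable 0 T (fun x => I lambda x * f x).
Proof.
have fi := square_integrable_cintegrable (L2_fun_square_integrable f).
have := cintegrableM_ccontinuous fi (is_cprimitive_continuous pi20
  (I_exp_cprimitive lambda)).
by under eq_fun do rewrite mulrC.
Qed.

Lemma forcing_cprimitive lambda g c : is_cprimitive 0 T
  (fun x => 'i%C * (c * (I lambda x * k x) - I lambda x * g x))
  (fun x => 'i%C * (c * cint 0 x (fun t => I lambda t * k t)
                    - cint 0 x (fun t => I lambda t * g t))).
Proof.
have pk := is_cprimitiveZ c pi20 (cint_is_cprimitive (cintegrable_I_expM lambda
  k)).
have pg := is_cprimitiveZ (-1) pi20 (cint_is_cprimitive (cintegrable_I_expM
  lambda g)).
apply: is_cprimitive_ext (is_cprimitiveZ 'i%C pi20 (is_cprimitiveD pk pg)) =>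
  x /=;
  by rewrite mulN1r.
Qed.

(** In the derivative of [I W] the terms containing [W] cancel, so integration determines [W] from
    [W 0]. Here [c] is a free parameter, not yet tied to the value at [T]. *)
Lemma ode_solution_unique lambda g c W x :
  is_cprimitive 0 T (ode lambda g c W) W -> x \in `[0, T] ->
  W x = (I lambda x)^-1 * (W 0 +
    'i%C * (c * cint 0 x (fun t => I lambda t * k t)
            - cint 0 x (fun t => I lambda t * g t))).
Proof.
move=> pW xI.
have pIW := is_cprimitiveM pi20 (I_exp_cprimitive lambda) pW.
have pF := forcing_cprimitive lambda g c.
have {}pIW : is_cprimitive 0 T
    (fun x => 'i%C * (c * (I lambda x * k x) - I lambda x * g x))
    (fun x => I lambda x * W x).
  by apply: is_cprimitive_ext pIW => y //; rewrite /ode_rhs; ring.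
have := is_cprimitiveE pIW xI; have := is_cprimitiveE pF xI.
rewrite !cint_pt mulr0 subrr mulr0 add0r I_exp0 mul1r => -> <-.
by rewrite mulKf ?I_exp_neq0.
Qed.

(** The converse: the product rule for [1 / I] and the integrated forcing term, with arbitrary
    initial value [d]. *)
Lemma ode_solution_exists lambda g c d (W := fun x => (I lambda x)^-1 * (d +
    'i%C * (c * cint 0 x (fun t => I lambda t * k t)
            - cint 0 x (fun t => I lambda t * g t)))) :
  is_cprimitive 0 T (ode lambda g c W) W.
Proof.
have pd := is_cprimitiveD (is_cprimitive_cst d pi20) (forcing_cprimitive lambda
  g c).
have := is_cprimitiveM pi20 (I_exp_inv_cprimitive lambda) pd.
apply: is_cprimitive_ext => x //=; rewrite /ode_rhs /W add0r.
have I0 := I_exp_neq0 lambda x; field; exact: I0.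
Qed.

Lemma shift_solution_cprimitive lambda g c :
  is_cprimitive 0 T (ode lambda g c (sol lambda g c)) (sol lambda g c).
Proof.
(* The initial value [rho * c] encodes the boundary condition for a solution equal to [c] at [T]. *)
have := ode_solution_exists lambda g c (rho * c); set W := fun x => _.
suff -> : W = sol lambda g c by [].
by apply/funext => x; rewrite /W /shift_solution /eigen_factor; congr (_ * _);
  ring.
Qed.

(** The remaining constraint is that the value at [T] be the parameter [c]; multiplied by
    [I lambda T], it becomes linear in [c] with coefficient [D lambda]. *)
Lemma shift_rel_solutionP lambda f g : shift_rel A lambda f g <->
  exists2 c, f =ae sol lambda g c &
    c * D lambda = - 'i%C * cint 0 T (fun t => I lambda t * g t).
Proof.
have IT := I_exp_neq0 lambda T.
split=> [/shift_relP[W [pW fW W0]]|[c fc cD]].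
  have WE x : x \in `[0, T] -> W x = sol lambda g (W T) x.
    move=> xI; rewrite (ode_solution_unique pW xI) W0.
    by rewrite /shift_solution /eigen_factor; congr (_ * _); ring.
  exists (W T).
    by apply: filterS fW => x /[swap] Ix /(_ Ix) ->; apply: WE;
      exact: sub_I2pi Ix.
  have IWT := congr1 ( *%R (I lambda T)) (WE T piI).
  rewrite /shift_solution mulVKf// in IWT.
  by rewrite mulrBr [_ * I _ _]mulrC IWT; ring.
apply/shift_relP; exists (sol lambda g c).
have WT : sol lambda g c T = c.
  apply: (mulfI IT); rewrite /shift_solution mulVKf//.
  by rewrite -[in LHS]mulNr -cD /char_fun; ring.
rewrite WT; split => //; first exact: shift_solution_cprimitive.
by rewrite /shift_solution /eigen_factor I_exp0 !cint_pt !mulr0 invr1 subr0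
  addr0 mul1r mulrC.
Qed.

Lemma shift_solution_continuous lambda g c :
  ccontinuous_on `[0, T] (sol lambda g c).
Proof. exact: is_cprimitive_continuous (shift_solution_cprimitive lambda g c).
  Qed.

Lemma shift_solutionE lambda g c : toL2 (sol lambda g c) =ae sol lambda g c.
Proof.
exact/toL2E/ccontinuous_square_integrable/shift_solution_continuous.
Qed.

(** * The resolvent where [D] does not vanish *)

Lemma shift_rel_unique lambda f g : D lambda != 0 -> shift_rel A lambda f g <->
  f =ae sol lambda g (- 'i%C * cint 0 T (fun t => I lambda t * g t) / D lambda).
Proof.
move=> D0; rewrite shift_rel_solutionP; split=> [[c fc cD]|fE].
  by rewrite -cD mulfK.
by eexists; [exact: fE|rewrite divfK].
Qed.

Lemma shift_rel_bijective lambda g : D lambda != 0 ->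
  exists! f, shift_rel A lambda f g.
Proof.
move=> D0; pose c := - 'i%C * cint 0 T (fun t => I lambda t * g t) / D lambda.
exists (toL2 (sol lambda g c)); split.
  exact/(shift_rel_unique _ _ D0)/shift_solutionE.
move=> f /(shift_rel_unique _ _ D0) fE; apply/L2_eqP.
by apply: filterS2 fE (shift_solutionE lambda g c) => x fE sE Ix;
  rewrite fE// sE.
Qed.

Lemma resolvent_shift_rel lambda g : D lambda != 0 ->
  shift_rel A lambda (resolvent A lambda g) g.
Proof.
move=> /(shift_rel_bijective g)[f [fg _]].
by rewrite /resolvent; case: xgetP => [h _ //|/(_ f)].
Qed.

(** The continuous functions [1 / I] and [m] are bounded, and [c] and the integral of [I g] are
    bounded by multiples of [L2norm g]. This gives a uniform bound on the solution, and [sqrt T]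
    converts it into an L^2 bound. *)
Lemma resolvent_bounded lambda : D lambda != 0 ->
  exists M : R, forall g, L2norm (resolvent A lambda g) <= M * L2norm g.
Proof.
move=> D0.
have [K K0 IK] := ccontinuous_bounded (is_cprimitive_continuous pi20
  (I_exp_cprimitive lambda)).
have [K' K'0 JK] := ccontinuous_bounded (is_cprimitive_continuous pi20
  (I_exp_inv_cprimitive lambda)).
have pm : is_cprimitive 0 T (fun x => 'i%C * (I lambda x * k x)) (m lambda).
  have pk := cint_is_cprimitive (cintegrable_I_expM lambda k).
  have := is_cprimitiveD (is_cprimitive_cst rho pi20) (is_cprimitiveZ 'i%C pi20
    pk).
  by apply: is_cprimitive_ext => x //=; rewrite add0r.
have [L L0 mL] := ccontinuous_bounded (is_cprimitive_continuous pi20 pm).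
pose C := 2 * K * (T + 1).
have normcNi : normc (- 'i%C : R[i]) =
  1 by rewrite /= oppr0 expr0n sqrrN expr1n add0r sqrtr1.
exists (Num.sqrt T * (K' * (C / normc (D lambda) * L + C))) => g.
have C0 : 0 <= C by rewrite !mulr_ge0// addr_ge0.
have G_le x : x \in `[0, T] ->
    normc (cint 0 x (fun t => I lambda t * g t)) <= C * L2norm g.
  by move=> xI; apply: normc_cintM_le => //; exact: cintegrable_I_expM.
have D'0 : 0 <= (normc (D lambda))^-1 by rewrite invr_ge0 normc_ge0.
rewrite -[leRHS]mulrA; apply: L2norm_le_bound.
  apply: mulr_ge0 (L2norm_ge0 g); apply: mulr_ge0 => //.
  by apply: addr_ge0 => //; apply: mulr_ge0 => //; exact: mulr_ge0.
have /(shift_rel_unique _ _ D0) := resolvent_shift_rel g D0.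
apply: filterS => x /[swap] Ix /(_ Ix) ->.
have xI : x \in `[0, T] by exact: sub_I2pi Ix.
rewrite /shift_solution normcM -[leRHS]mulrA ler_pM ?normc_ge0//;
  first exact: JK.
rewrite -(mulNr 'i%C) [leRHS]mulrDl;
  apply: le_trans (le_normcD (_ : Rcomplex R) _) _.
apply: lerD; last by rewrite normcM normcNi mul1r G_le.
rewrite [leRHS]mulrAC normcM ler_pM ?normc_ge0 ?mL// [leRHS]mulrAC.
by rewrite !normcM normcNi mul1r normcV ler_wpM2r ?G_le.
Qed.

(** * Kernel, eigenfunctions and spectrum *)

Lemma L2_fun0 : (0 : L2 R) =ae cst 0.
Proof.
have := L2_funZ 0 (0 : L2 R); rewrite scaler0.
by apply: filterS => x /[apply] ->; rewrite mul0r.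
Qed.

Lemma shift_solution0 lambda c x : x \in `[0, T] ->
  sol lambda 0 c x = c * ((I lambda x)^-1 * m lambda x).
Proof.
move=> xI; rewrite /shift_solution.
(* The chosen representative of the zero class is known to vanish only almost everywhere. *)
have <- : cint 0 x (cst 0) = cint 0 x (fun t => I lambda t * (0 : L2 R) t).
  apply: eq_cint => //.
  - apply: cmeasurableM; last exact: L2_cmeasurable.
    have Ic := is_cprimitive_continuous pi20 (I_exp_cprimitive lambda).
    by have [] := ccontinuous_square_integrable Ic.
  - exact: is_cprimitive_integrable (is_cprimitive_cst 0 pi20).
  - by apply: filterS L2_fun0 => t /[apply] ->; rewrite mulr0.
have := is_cprimitiveE (is_cprimitive_cst 0 pi20) xI.
by rewrite /cst add0r => <-; rewrite mulr0 subr0 mulrCA.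
Qed.

Lemma ker_shiftP lambda f : ker_shift A lambda f <->
  exists2 c, f =ae (fun x => c * ((I lambda x)^-1 * m lambda x)) &
    c * D lambda = 0.
Proof.
rewrite /ker_shift /= shift_rel_solutionP.
have solE c x : I2pi x -> sol lambda 0 c x = c * ((I lambda x)^-1 * m lambda x).
  by move=> Ix; apply: shift_solution0; exact: sub_I2pi Ix.
(* With [c = 0] at [T], [shift_solution0] isolates this term, up to the nonzero factor [1 / I]. *)
have -> : - 'i%C * cint 0 T (fun t => I lambda t * (0 : L2 R) t) = 0.
  have := shift_solution0 lambda 0 piI; rewrite /shift_solution !mul0r sub0r.
  move/eqP; rewrite mulf_eq0 invr_eq0 (negPf (I_exp_neq0 _ _)) /= => /eqP.
  by rewrite mulNr.
split=> -[c fc cD]; exists c => //.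
- by apply: filterS fc => x fx Ix; rewrite fx// solE.
- by apply: filterS fc => x fx Ix; rewrite fx// solE.
Qed.

Lemma eigenvalue_char_fun lambda : is_eigenvalue A lambda -> D lambda = 0.
Proof.
move=> [f [f0 /ker_shiftP[c fc /eqP]]];
  rewrite mulf_eq0 => /orP[/eqP c0|/eqP//].
exfalso; move/eqP: f0; apply; apply/L2_eqP.
by apply: filterS2 fc L2_fun0 => x fx zx Ix; rewrite fx// zx// c0 mul0r.
Qed.

(** When [D lambda = 0] every [c] is admissible, so the kernel is a line. Its generator is nonzero
    because its continuous representative equals [a * rho] at 0. The scalar [a] leaves the
    normalisation open. *)
Lemma eigenfunction_of_char_fun lambda (a : R[i]) : rho != 0 -> a != 0 ->
  D lambda = 0 ->
  exists phi : L2 R,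
    [/\ phi =ae (fun x => a * ((I lambda x)^-1 * m lambda x)),
        is_eigenfunction A lambda phi &
        forall f, ker_shift A lambda f -> exists c, f = c *: phi].
Proof.
move=> rho0 a0 D0.
have pE : toL2 (sol lambda 0 a) =ae (fun x =>
  a * ((I lambda x)^-1 * m lambda x)).
  apply: filterS (shift_solutionE lambda 0 a) => x sx Ix; rewrite sx//.
  by apply: shift_solution0; exact: sub_I2pi Ix.
exists (toL2 (sol lambda 0 a)); split => //.
  split; last by apply/ker_shiftP; exists a => //; rewrite D0 mulr0.
  apply/negP => /eqP p0.
  have s0 : {in `[0, T], sol lambda 0 a =1 cst 0}.
    apply: ccontinuous_ae_eq; first exact: shift_solution_continuous.
    - exact: is_cprimitive_continuous (is_cprimitive_cst 0 pi20).
    - have := shift_solutionE lambda 0 a; rewrite p0.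
      by apply: filterS2 L2_fun0 => x zx sx Ix; rewrite -sx// zx.
  have := s0 0 zeroI; rewrite shift_solution0// I_exp0 /eigen_factor cint_pt.
  rewrite mulr0 addr0 invr1 mul1r => /eqP.
  by rewrite mulf_eq0 (negPf a0) (negPf rho0).
move=> f /ker_shiftP[c fc _]; exists (c / a); apply/L2_eqP.
have := L2_funZ (c / a) (toL2 (sol lambda 0 a)).
apply: filterS3 fc pE => x fx px zx Ix.
by rewrite fx// zx// px// [RHS]mulrA divfK.
Qed.

Lemma has_dim_ker_shift lambda : rho != 0 -> D lambda = 0 ->
  has_dim (ker_shift A lambda) 1.
Proof.
move=> rho0 D0.
have [phi [phiE [phi0 kphi] kerE]] :=
  eigenfunction_of_char_fun rho0 (oner_neq0 R[i]) D0.
exists (fun=> phi); split.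
  move=> c; rewrite big_ord1 => /eqP; rewrite scaler_eq0 (negPf phi0) orbF.
  by move=> /eqP c0 i; rewrite ord1.
apply/seteqP; split=> f.
  by move=> /kerE[c ->]; exists (fun=> c); rewrite big_ord1.
move=> [c ->]; rewrite big_ord1; apply/ker_shiftP.
exists (c ord0); last by rewrite D0 mulr0.
have := L2_funZ (c ord0) phi; apply: filterS2 phiE => x px zx Ix.
by rewrite zx// px// mul1r.
Qed.

(** Off the zeros of [D] the inverse exists and is bounded; at a zero, an eigenfunction and 0 both
    solve the equation with [g = 0]. *)
Lemma spectrum_char_fun : rho != 0 -> spectrum A = [set lambda | D lambda = 0].
Proof.
move=> rho0; apply/seteqP; split=> lambda /=.
  move=> nres; apply/eqP/negPn/negP => D0; apply: nres; split.
    by move=> g; exact: shift_rel_bijective.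
  exact: resolvent_bounded.
move=> D0 [/(_ 0)[f [_ fu]] _].
have [phi [_ [phi0 kphi] _]] :=
  eigenfunction_of_char_fun rho0 (oner_neq0 R[i]) D0.
have k0 : ker_shift A lambda 0.
  apply/ker_shiftP; exists 0; last by rewrite mul0r.
  by apply: filterS L2_fun0 => x /[apply] ->; rewrite mul0r.
by move: phi0; rewrite -(fu _ kphi) (fu _ k0) eqxx.
Qed.

(** * The characteristic equation in exponential form *)

Lemma cint_VB lambda x : x \in `[0, T] ->
  cint 0 x (fun t => V t - lambda) = cint 0 x V - lambda * x%:C.
Proof.
move=> xI.
have pV := cint_is_cprimitive (Linfty_cintegrable hV).
have pl := is_cprimitiveZ (- lambda) pi20 (@is_cprimitive_id R 0 T).
have := is_cprimitiveE (is_cprimitiveD pV pl) xI.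
rewrite cint_pt add0r mulr0 add0r mulNr => ->.
by congr cint; apply/funext => t /=; rewrite mulr1.
Qed.

Lemma eq_cint_in a b u v : {in `[a, b], u =1 v} -> cint a b u = cint a b v.
Proof.
move=> uv; rewrite /cint; congr (_ +i* _); apply: eq_Rintegral => x;
  by rewrite inE => /uv ->.
Qed.

(** The left side of the equation is [m lambda T / I lambda T], which equals 1 exactly when
    [D lambda = 0]. *)
Lemma char_fun_eq0 lambda :
  cexp ('i%C * cint 0 T (fun t => V t - lambda)) *
    ('i%C * cint 0 T (fun t =>
       cexp (- 'i%C * cint 0 t (fun s => V s - lambda)) * k t) + rho) = 1 <->
  D lambda = 0.
Proof.
have IE x : x \in `[0, T] ->
    cexp (- 'i%C * cint 0 x (fun s => V s - lambda)) = I lambda x.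
  by move=> xI; rewrite cint_VB//; rewrite /I_exp; congr cexp; ring.
have -> : cint 0 T (fun t => cexp (- 'i%C * cint 0 t (fun s =>
  V s - lambda)) * k t)
    = cint 0 T (fun t => I lambda t * k t).
  by apply: eq_cint_in => t tI; rewrite IE.
have -> : cexp ('i%C * cint 0 T (fun t => V t - lambda)) = (I lambda T)^-1.
  by rewrite -IE// -cexpN mulNr opprK.
rewrite [_ + rho]addrC -/(m lambda T) /char_fun.
have IT := I_exp_neq0 lambda T.
split=> [/(congr1 ( *%R (I lambda T)))|/subr0_eq <-].
  by rewrite mulVKf// mulr1 => ->; rewrite subrr.
by rewrite mulVf.
Qed.

End ResolventEquation.

(** * Spectrum, eigenfunctions and the resolvent formula *)

Theorem theorem3p1 (R : realType) (V : R -> R[i]) (rho : R[i]) (k : L2 R)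
    (hV : Linfty V) (hrho : rho != 0) :
  let A := A_op V rho k in
  [/\ spectrum A = [set lambda | is_eigenvalue A lambda],
      spectrum A = [set lambda |
        cexp ('i%C * cint 0 (2 * pi) (fun t => V t - lambda)) *
        ('i%C * cint 0 (2 * pi) (fun t =>
           cexp (- 'i%C * cint 0 t (fun s => V s - lambda)) * k t) + rho) = 1],
      forall lambda, is_eigenvalue A lambda -> has_dim (ker_shift A lambda) 1,
      forall lambda, is_eigenvalue A lambda ->
        exists phi : L2 R,
          [/\ (phi : R -> R[i]) = (fun x =>
                (Num.sqrt (2 * pi))^-1%:C *
                cexp ('i%C * cint 0 x V - 'i%C * lambda * x%:C) *
                ('i%C * cint 0 x (fun t =>
                   cexp (- 'i%C * cint 0 t V + 'i%C * lambda * t%:C) * k t) + rho))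
                %[ae lebesgue_measure in I2pi],
              is_eigenfunction A lambda phi &
              forall f : L2 R, is_eigenfunction A lambda f ->
                exists2 c : R[i], c != 0 & f = c *: phi] &
      forall lambda, ~ spectrum A lambda -> forall g : L2 R,
        (resolvent A lambda g : R -> R[i]) = (fun x =>
          - 'i%C / I_exp V lambda x *
          (cint 0 (2 * pi) (fun t => I_exp V lambda t * g t) /
             (I_exp V lambda (2 * pi)
              - 'i%C * cint 0 (2 * pi) (fun t => I_exp V lambda t * k t) - rho) *
           (cint 0 x (fun t => 'i%C * I_exp V lambda t * k t) + rho) +
           cint 0 x (fun t => I_exp V lambda t * g t)))
          %[ae lebesgue_measure in I2pi]].
Proof.
have specE := spectrum_char_fun k hV hrho.
(* The normalising constant serves as the scalar [a] of [eigenfunction_of_char_fun]. *)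
have a0 : (Num.sqrt (2 * pi))^-1%:C != 0 :> R[i].
  rewrite eq_complex /= eqxx andbT invr_eq0 sqrtr_eq0 -ltNge.
  exact: two_pi_gt0.
split.
- rewrite specE; apply/seteqP; split=> lambda /=;
    last exact: eigenvalue_char_fun.
  by move=> /(eigenfunction_of_char_fun hV hrho a0)[phi [_ ? _]]; exists phi.
- by rewrite specE; apply/seteqP; split=> lambda /=;
    rewrite (char_fun_eq0 rho k hV).
- by move=> lambda /(eigenvalue_char_fun hV); exact: has_dim_ker_shift.
- move=> lambda /(eigenvalue_char_fun hV).
  move=> /(eigenfunction_of_char_fun hV hrho a0)[phi [phiE ephi kerE]].
  exists phi; split => //.
    apply: filterS phiE => x /[apply] ->.
    rewrite -mulrA /eigen_factor [_ + rho]addrC /I_exp -cexpN.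
    by congr (_ * (cexp _ * _)); ring.
  move=> f [f0 /kerE[c fE]]; exists c => //.
  by apply: contra_neq f0 => c0; rewrite fE c0 scale0r.
move=> lambda nspec g.
have D0 : char_fun V rho k lambda != 0.
  by apply/eqP => D0; apply: nspec; rewrite specE.
have /(shift_rel_unique hV _ _ D0) := resolvent_shift_rel hV g D0.
apply: filterS => x /[swap] Ix /(_ Ix) ->.
have xI : x \in `[0, 2 * pi] by exact: sub_I2pi Ix.
(* The formula has the factor [i] inside this integral, whereas [eigen_factor] has it outside. *)
have -> : cint 0 x (fun t => 'i%C * I_exp V lambda t * k t) =
    'i%C * cint 0 x (fun t => I_exp V lambda t * k t).
  rewrite -cintZ; last 2 first.
  - by move: xI; rewrite in_itv/= => /andP[].
  - exact: cintegrableS xI (cintegrable_I_expM hV lambda k).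
  by congr cint; apply/funext => t; rewrite mulrA.
rewrite /shift_solution.
have <- : char_fun V rho k lambda = I_exp V lambda (2 * pi) -
    'i%C * cint 0 (2 * pi) (fun t => I_exp V lambda t * k t) - rho.
  by rewrite /char_fun /eigen_factor; ring.
rewrite /eigen_factor; field.
by rewrite D0 I_exp_neq0.
Qed.
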